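(* Let $V$ be a finite-dimensional diffeological vector space endowed with a pseudo-metric $g$. For any choice of a characteristic subspace $V_0$ of $V$, with $g_0$ the restriction of $g$ to $V_0$, the Clifford algebra $C\ell(V_0,g_0)$ (regarded as a subspace of $C\ell(V,g)$ via the inclusion $V_0\hookrightarrow V$) splits off smoothly in $C\ell(V,g)$.
   Context: A diffeological space is a set $X$ with a collection of maps (plots) $U\to X$, for $U$ open in $\mathbb{R}^n$, $n\in\mathbb{N}$, such that: constant maps are plots; the composition of a plot with an ordinary smooth map between open sets of Euclidean spaces is a plot; a map that is locally a plot is a plot. A map is smooth if its composition with every plot is a plot. A diffeological vector space is a real vector space with a diffeology for which addition and scalar multiplication are smooth (a vector space diffeology; products carry the product diffeology). Subspaces carry the subset diffeology (plots of the ambient space with image in the subspace), quotients the quotient diffeology (maps that locally lift to plots). The diffeological dual $V^*$ is the vector space of smooth linear maps $V\to\mathbb{R}$. A diffeological pseudo-metric on $V$ of finite dimension $n$ is a smooth symmetric semi-positive definite bilinear form $g:V\times V\to\mathbb{R}$ whose maximal isotropic subspace ($\{v\in V: g(v,w)=0\ \forall w\in V\}$) has dimension exactly $n-\dim(V^* )$. A characteristic subspace of $V$ is obtained by choosing a basis of $V$ (identifying $V$ with $\mathbb{R}^n$), taking the matrix $A$ of a pseudo-metric in this basis, and letting $V_0$ be the subspace generated by the vectors whose coordinates are eigenvectors of $A$ belonging to positive eigenvalues; it depends on the basis but not on the pseudo-metric, and $V=V_0\oplus V_1$ is a smooth decomposition, where $V_1$ is the maximal isotropic subspace. A decomposition $E=E_1\oplus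 E_2$ of a diffeological vector space into subspaces is smooth if the diffeology of $E$ coincides with the product diffeology obtained from the subset diffeologies on $E_1,E_2$; a subspace splits off smoothly if it is a summand of some smooth decomposition into two subspaces. The tensor product of diffeological vector spaces is the usual one, with the quotient diffeology of the finest vector space diffeology on the free vector space on the product set that contains the product diffeology. The tensor algebra $T(V)=\bigoplus_{k\ge 0}V^{\otimes k}$ carries the direct sum diffeology: its plots are locally finite sums of plots of the summands $V^{\otimes k}$. For a smooth symmetric bilinear form $q$ on $V$, the Clifford algebra $C\ell(V,q)$ is the quotient $T(V)/I(V)$, with the quotient diffeology, where $I(V)$ is the two-sided ideal generated by all elements $v\otimes w+w\otimes v+4q(v,w)$, $v,w\in V$. *)

(* Defs.v *)
From HB Require Import structures.
From mathcomp Require Import all_boot all_order all_algebra.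
From mathcomp Require Import finmap.
From mathcomp Require Import all_classical all_reals topology normedtype landau derive.
From mathcomp Require Import -(notations) monalg.

Set Implicit Arguments.
Unset Strict Implicit.
Unset Printing Implicit Defensive.
Import Order.TTheory GRing.Theory Num.Theory numFieldNormedType.Exports.
Local Open Scope classical_set_scope.
Local Open Scope ring_scope.
Local Open Scope quotient_scope.

Section smooth_maps.
Context {R : realType}.
Implicit Types E F : normedModType R.

(* For open U, [Ck k.+1 U f] asks for Frechet differentiability at every point
   of U and for all directional derivatives to be Ck; so [smooth_on U f] is
   C^infinity on U. *)
Fixpoint Ck E F (k : nat) (U : set E) (f : E -> F) : Prop :=
  match k with
  | 0 => forall x, U x -> {for x, continuous f}
  | k'.+1 => (forall x, U x -> differentiable f x)
             /\ forall v, Ck k' U ('D_v f)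
  end.

Definition smooth_on E F (U : set E) (f : E -> F) : Prop :=
  forall k, Ck k U f.

Lemma near_eq_differentiable E F (f g : E -> F) (x : E) :
  (\near x, f x = g x) -> differentiable g x -> differentiable f x.
Proof.
move=> fg /diff_locallyP[gc go].
have fgx : f x = g x by exact: nbhs_singleton fg.
have fo : f \o shift x = cst (f x) + 'd g x +o_ 0 id.
  apply/eqaddoP => e e0.
  move/eqaddoP : go => /(_ e e0) ge.
  have fg0 : \forall h \near (0 : E), f (h + x) = g (h + x).
    by have := fg; rewrite (near_shift 0 x) /= subr0.
  apply: filterS2 fg0 ge => h fgh.
  by rewrite [in X in X -> _]/= !fctE /= fgh fgx.
by apply/diff_locallyP; rewrite (diff_unique gc fo).
Qed.

Lemma Ck_local E F k (U : set E) (f : E -> F) :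
  (forall x, U x -> exists W g, [/\ open W, W x, Ck k W g
                                  & forall y, W y -> f y = g y]) ->
  Ck k U f.
Proof.
have fgnear : forall (W : set E) (f g : E -> F) x, open W -> W x ->
    (forall y, W y -> f y = g y) -> \near x, f x = g x.
  move=> W f1 g x oW Wx fg.
  by apply: filterS (open_nbhs_nbhs (conj oW Wx)) => y /fg.
elim: k U f => [|k IH] U f Uf /=.
  move=> x /Uf[W [g [oW Wx Cg fg]]].
  rewrite /prop_for /continuous_at (fg x Wx).
  apply: cvg_trans (Cg _ Wx); apply: near_eq_cvg.
  by apply: (fgnear W) => // y /fg.
split=> [x /Uf[W [g [oW Wx [Cg _] fg]]]|v].
  by apply: near_eq_differentiable (Cg _ Wx); exact: (fgnear W).
apply: IH => x /Uf[W [g [oW Wx [_ Cg] fg]]].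
exists W, ('D_v g); split => [//|//||y Wy]; first exact: Cg.
by apply: near_eq_derive; exact: (fgnear W).
Qed.

Lemma Ck_eq E F k (U : set E) (f g : E -> F) :
  open U -> (forall x, U x -> f x = g x) -> Ck k U g -> Ck k U f.
Proof. by move=> oU fg Cg; apply: Ck_local => x Ux; exists U, g. Qed.

Lemma Ck_sub E F k (U W : set E) (f : E -> F) :
  W `<=` U -> Ck k U f -> Ck k W f.
Proof.
move=> WU; elim: k f => [|k IH] f /=; first by move=> Cf x /WU /Cf.
by move=> [df Cf]; split=> [x /WU /df//|v]; exact: IH.
Qed.

Lemma CkS E F k (U : set E) (f : E -> F) : Ck k.+1 U f -> Ck k U f.
Proof.
elim: k f => [|k IH] f.
  by move=> [df _] x /df; exact: differentiable_continuous.
by move=> [df Cf]; split=> // v; apply: IH; exact: Cf.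
Qed.

Lemma Ck_cst E F k (U : set E) (a : F) : Ck k U (fun=> a).
Proof.
elim: k a => [|k IH] a /=; first by move=> x _; exact: cst_continuous.
split=> [x _|v]; first exact: differentiable_cst.
rewrite (_ : 'D_v _ = fun=> 0) //.
by apply/funext => x; exact: derive_cst.
Qed.

Lemma CkD E F k (U : set E) (f g : E -> F) : open U ->
  Ck k U f -> Ck k U g -> Ck k U (fun x => f x + g x).
Proof.
move=> oU; elim: k f g => [|k IH] f g.
  by move=> Cf Cg x Ux; apply: continuousD; [exact: Cf|exact: Cg].
move=> [df Cf] [dg Cg]; split=> [x Ux|v].
  by apply: differentiableD; [exact: df|exact: dg].
apply: (Ck_eq oU); last by apply: IH; [exact: Cf|exact: Cg].
by move=> x Ux /=; rewrite deriveD //; apply: diff_derivable; [exact: df|exact: dg].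
Qed.

Lemma CkM E k (U : set E) (f g : E -> R) : open U ->
  Ck k U f -> Ck k U g -> Ck k U (fun x => f x * g x).
Proof.
move=> oU; elim: k f g => [|k IH] f g.
  by move=> Cf Cg x Ux; apply: continuousM; [exact: Cf|exact: Cg].
move=> Cf0 Cg0; move: (Cf0) (Cg0) => [df Cf] [dg Cg].
split=> [x Ux|v].
  by apply: differentiableM; [exact: df|exact: dg].
apply: (@Ck_eq _ _ _ _ _ (fun x => f x * 'D_v g x + g x * 'D_v f x)) => //.
  move=> x Ux /=.
  by rewrite deriveM //; apply: diff_derivable; [exact: df|exact: dg].
by apply: CkD => //; apply: IH; [exact: CkS|exact: Cg|exact: CkS|exact: Cf].
Qed.

Lemma Ck_sum E F k (U : set E) n (f : 'I_n -> E -> F) : open U ->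
  (forall i, Ck k U (f i)) -> Ck k U (fun x => \sum_i f i x).
Proof.
move=> oU; elim: n f => [|n IH] f Cf.
  rewrite (_ : (fun x => _) = fun=> 0); first exact: Ck_cst.
  by apply/funext => x; rewrite big_ord0.
rewrite (_ : (fun x => _) = fun x => f ord0 x + \sum_i f (lift ord0 i) x).
  by apply: CkD => //; exact: IH.
by apply/funext => x; rewrite big_ord_recl.
Qed.

Lemma Ck_coord E k (U : set E) n (f : E -> 'rV[R]_n) i : open U ->
  Ck k U f -> Ck k U (fun x => f x 0 i).
Proof.
move=> oU; elim: k f => [|k IH] f.
  move=> Cf x Ux; have /= := (@continuous_comp _ _ _ f (fun M : 'rV[R]_n => M 0 i) x).
  by apply; [exact: Cf|exact: coord_continuous].
move=> [df Cf]; split=> [x Ux|v].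
  apply: (@differentiable_comp _ _ _ _ f (fun M : 'rV[R]_n => M 0 i : R)).
    exact: df.
  exact: differentiable_coord.
apply: (Ck_eq oU); last by apply: IH; exact: (Cf v).
move=> x Ux /=; rewrite derive_mx; first by rewrite mxE.
by apply: diff_derivable; exact: df.
Qed.

Lemma open_preim E F (U : set E) (W : set F) (h : E -> F) :
  open U -> open W -> (forall x, U x -> {for x, continuous h}) ->
  open (U `&` h @^-1` W).
Proof.
move=> oU oW hc; rewrite openE => x [Ux Whx]; apply: filterI.
  exact: (open_nbhs_nbhs (conj oU Ux)).
by apply: (hc x Ux); exact: (open_nbhs_nbhs (conj oW Whx)).
Qed.

Lemma Ck_comp m n k (U : set 'rV[R]_m) (W : set 'rV[R]_n)
    (h : 'rV[R]_m -> 'rV[R]_n) (g : 'rV[R]_n -> R) :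
  open U -> (forall x, U x -> W (h x)) ->
  Ck k U h -> Ck k W g -> Ck k U (g \o h).
Proof.
move=> oU UW; elim: k g => [|k IH] g.
  by move=> Ch Cg x Ux; apply: continuous_comp; [exact: Ch|apply: Cg; exact: UW].
move=> Ch0 Cg0; move: (Ch0) (Cg0) => [dh Ch] [dg Cg].
split=> [x Ux|v].
  by apply: differentiable_comp; [exact: dh|apply: dg; exact: UW].
apply: (@Ck_eq _ _ _ _ _ (fun x => \sum_i ('D_v h x) 0 i *
          ('D_(delta_mx 0 i) g \o h) x)) => // [x Ux|].
  have dhx := dh _ Ux; have dgx := dg _ (UW _ Ux).
  have dgh : differentiable (g \o h) x by exact: differentiable_comp.
  have -> : 'D_v (g \o h) x = 'd g (h x) ('D_v h x).
    by rewrite (deriveE v dgh) (diff_comp dhx dgx) /= -(deriveE v dhx).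
  rewrite {1}(row_sum_delta ('D_v h x)) linear_sum /=.
  by apply: eq_bigr => i _; rewrite linearZ /= (deriveE _ dgx).
apply: Ck_sum => // i; apply: CkM => //; first exact: (Ck_coord _ oU (Ch v)).
by apply: IH => //; [exact: CkS|exact: Cg].
Qed.

Lemma Ck_id E k (U : set E) : Ck k U id.
Proof.
case: k => [|k] /=; first by move=> x _.
split=> [x _|v]; first by exact: ex_diff.
rewrite (_ : 'D_v _ = fun=> v); first exact: Ck_cst.
by apply/funext => x; exact: derive_id.
Qed.

End smooth_maps.

Section diffeologies.
Context {R : realType}.

(* A plot U -> X is encoded as a total function on R^n together with its open
   domain U; [plot_local] makes the values outside U irrelevant. *)
Record diffeology (X : Type) := Diffeology {
  plot : forall n : nat, set 'rV[R]_n -> ('rV[R]_n -> X) -> Prop;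
  plot_open : forall n U p, @plot n U p -> open U;
  plot_cst : forall n (U : set 'rV[R]_n) (x : X), open U -> plot U (fun=> x);
  plot_comp : forall m n (U : set 'rV[R]_m) (W : set 'rV[R]_n)
      (h : 'rV[R]_m -> 'rV[R]_n) (p : 'rV[R]_n -> X),
    open U -> (forall x, U x -> W (h x)) -> smooth_on U h ->
    plot W p -> plot U (p \o h);
  plot_local : forall n (U : set 'rV[R]_n) (p : 'rV[R]_n -> X), open U ->
    (forall x, U x -> exists W q,
        [/\ W x, W `<=` U, plot W q & forall y, W y -> p y = q y]) ->
    plot U p
}.

Definition smooth X Y (D : diffeology X) (D' : diffeology Y) (f : X -> Y) :=
  forall n (U : set 'rV[R]_n) p, plot D U p -> plot D' U (f \o p).

Lemma plot_eq X (D : diffeology X) n (U : set 'rV[R]_n) p q :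
  (forall x, U x -> p x = q x) -> plot D U q -> plot D U p.
Proof.
move=> pq Dq; apply: plot_local => [|x Ux]; first exact: plot_open Dq.
by exists U, q; split.
Qed.

Lemma plot_sub X (D : diffeology X) n (U W : set 'rV[R]_n) p :
  open W -> W `<=` U -> plot D U p -> plot D W p.
Proof.
move=> oW WU Dp; apply: (plot_comp (h := id) oW WU _ Dp) => k.
exact: Ck_id.
Qed.

Lemma smooth_preim_open m n (U : set 'rV[R]_m) (W : set 'rV[R]_n) h :
  open U -> open W -> smooth_on U h -> open (U `&` h @^-1` W).
Proof. by move=> oU oW sh; apply: open_preim => //; exact: (sh 0%N). Qed.

Lemma smooth_on_sub m n (U W : set 'rV[R]_m) (h : 'rV[R]_m -> 'rV[R]_n) :
  W `<=` U -> smooth_on U h -> smooth_on W h.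
Proof. by move=> WU sh k; apply: Ck_sub (sh k). Qed.

Section standard.

Definition std_plot n (U : set 'rV[R]_n) (p : 'rV[R]_n -> R) :=
  open U /\ smooth_on U p.

Program Definition std_diffeology : diffeology R :=
  @Diffeology R std_plot _ _ _ _.
Next Obligation. by move=> n U p []. Qed.
Next Obligation. by move=> n U x oU; split=> // k; exact: Ck_cst. Qed.
Next Obligation.
move=> m n U W h p oU UW sh [oW sp]; split=> // k.
exact: Ck_comp (sh k) (sp k).
Qed.
Next Obligation.
move=> n U p oU Up; split=> // k; apply: Ck_local => x /Up[W [q [Wx _ [oW sq] pq]]].
by exists W, q.
Qed.

End standard.

Section product.
Context {X Y : Type} (D : diffeology X) (D' : diffeology Y).

Definition prod_plot n (U : set 'rV[R]_n) (p : 'rV[R]_n -> X * Y) :=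
  plot D U (fst \o p) /\ plot D' U (snd \o p).

Program Definition prod_diffeology : diffeology (X * Y) :=
  @Diffeology _ prod_plot _ _ _ _.
Next Obligation. by move=> n U p [/plot_open]. Qed.
Next Obligation. by move=> n U x oU; split; exact: plot_cst. Qed.
Next Obligation.
move=> m n U W h p oU UW sh [Dp D'p].
by split; [exact: plot_comp Dp|exact: plot_comp D'p].
Qed.
Next Obligation.
move=> n U p oU Up; split; apply: plot_local => // x /Up[W [q [Wx WU [Dq D'q] pq]]].
  by exists W, (fst \o q); split=> // y Wy /=; rewrite pq.
by exists W, (snd \o q); split=> // y Wy /=; rewrite pq.
Qed.

End product.

Section power.
Context {X : Type} (D : diffeology X) (k : nat).

Definition power_plot n (U : set 'rV[R]_n) (p : 'rV[R]_n -> k.-tuple X) :=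
  open U /\ forall i, plot D U (fun x => tnth (p x) i).

Program Definition power_diffeology : diffeology (k.-tuple X) :=
  @Diffeology _ power_plot _ _ _ _.
Next Obligation. by move=> n U p []. Qed.
Next Obligation. by move=> n U x oU; split=> // i; exact: plot_cst. Qed.
Next Obligation.
move=> m n U W h p oU UW sh [oW Dp]; split=> // i; exact: (plot_comp _ _ _ (Dp i)).
Qed.
Next Obligation.
move=> n U p oU Up; split=> // i; apply: plot_local => // x.
move=> /Up[W [q [Wx WU [oW Dq] pq]]].
by exists W, (fun x => tnth (q x) i); split=> // y Wy; rewrite pq.
Qed.

End power.

Section pullback.
Context {X Y : Type} (f : X -> Y) (D : diffeology Y).

Definition pullback_plot n (U : set 'rV[R]_n) (p : 'rV[R]_n -> X) :=
  plot D U (f \o p).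

Program Definition pullback_diffeology : diffeology X :=
  @Diffeology _ pullback_plot _ _ _ _.
Next Obligation. by move=> n U p /plot_open. Qed.
Next Obligation. by move=> n U x oU; exact: plot_cst. Qed.
Next Obligation. by move=> m n U W h p oU UW sh; exact: plot_comp. Qed.
Next Obligation.
move=> n U p oU Up; apply: plot_local => // x /Up[W [q [Wx WU Dq pq]]].
by exists W, (f \o q); split=> // y Wy /=; rewrite pq.
Qed.

End pullback.

(* For A a subset of X this is the diffeology of the plots of X with values in
   A; subspaces {vspace V} get it through [pullback_diffeology vsval]. *)
Definition subset_diffeology X (D : diffeology X) (A : set X) :
  diffeology A := pullback_diffeology set_val D.

Section quotient.
Context {X Y : Type} (f : X -> Y) (f_surj : forall y, exists x, f x = y).
Context (D : diffeology X).

Definition quotient_plot n (U : set 'rV[R]_n) (p : 'rV[R]_n -> Y) :=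
  open U /\ forall x, U x -> exists W q,
    [/\ W x, W `<=` U, plot D W q & forall y, W y -> p y = f (q y)].

Program Definition quotient_diffeology : diffeology Y :=
  @Diffeology _ quotient_plot _ _ _ _.
Next Obligation. by move=> n U p []. Qed.
Next Obligation.
move=> n U y oU; split=> // x Ux; have [z <-] := f_surj y.
by exists U, (fun=> z); split=> //; exact: plot_cst.
Qed.
Next Obligation.
move=> m n U W h p oU UW sh [oW Wp]; split=> // x Ux.
have [W' [q [W'x W'W Dq pq]]] := Wp _ (UW _ Ux).
exists (U `&` h @^-1` W'), (q \o h); split=> //.
- apply: (plot_comp _ _ _ Dq).
  + exact: smooth_preim_open (plot_open Dq) sh.
  + by move=> y [].
  + by apply: smooth_on_sub sh => y [].
- by move=> y [Uy W'hy] /=; rewrite pq.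
Qed.
Next Obligation.
move=> n U p oU Up; split=> // x Ux; have [W [q [Wx WU [oW Wq] pq]]] := Up _ Ux.
have [W' [r [W'x W'W Dr qr]]] := Wq _ Wx.
exists W', r; split=> //; first exact: subset_trans W'W WU.
by move=> y W'y; rewrite pq ?qr //; exact: W'W.
Qed.

End quotient.

Definition vs_diffeology (V : lmodType R) (D : diffeology V) : Prop :=
  smooth (prod_diffeology D D) D (fun x => x.1 + x.2) /\
  smooth (prod_diffeology std_diffeology D) D (fun x => x.1 *: x.2).

Section finest.
Context {X : Type} {V : lmodType R} (D : diffeology X) (f : X -> V).

Definition finest_vs_plot n (U : set 'rV[R]_n) (p : 'rV[R]_n -> V) :=
  open U /\
  forall D' : diffeology V, vs_diffeology D' -> smooth D D' f -> plot D' U p.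

(* The finest vector space diffeology on V for which f is smooth, i.e. the
   intersection of all of them. *)
Program Definition finest_vs_diffeology : diffeology V :=
  @Diffeology _ finest_vs_plot _ _ _ _.
Next Obligation. by move=> n U p []. Qed.
Next Obligation. by move=> n U x oU; split=> // D' _ _; exact: plot_cst. Qed.
Next Obligation.
move=> m n U W h p oU UW sh [oW Wp]; split=> // D' vD' sf.
by apply: plot_comp (Wp D' vD' sf).
Qed.
Next Obligation.
move=> n U p oU Up; split=> // D' vD' sf; apply: plot_local => // x.
move=> /Up[W [q [Wx WU [oW Wq] pq]]].
by exists W, q; split=> //; exact: Wq.
Qed.

End finest.

Lemma finest_vs_vs X (V : lmodType R) (D : diffeology X) (f : X -> V) :
  vs_diffeology (finest_vs_diffeology D f).
Proof.
split=> n U p [] /= p1 [oU p2]; split=> // D' vD' sf.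
  by apply: vD'.1; split; [exact: p1.2|exact: p2].
by apply: vD'.2; split; [exact: p1|exact: p2].
Qed.

Lemma finest_vs_smooth X (V : lmodType R) (D : diffeology X) (f : X -> V) :
  smooth D (finest_vs_diffeology D f) f.
Proof.
move=> n U p Dp; split; first exact: plot_open Dp.
by move=> D' _; apply.
Qed.

Lemma finest_vs_min X (V : lmodType R) (D : diffeology X) (f : X -> V)
    (D' : diffeology V) : vs_diffeology D' -> smooth D D' f ->
  forall n (U : set 'rV[R]_n) p,
    plot (finest_vs_diffeology D f) U p -> plot D' U p.
Proof. by move=> vD' sf n U p [_]; apply. Qed.

End diffeologies.
Arguments diffeology R X : clear implicits.
Arguments plot {R X} d {n} U p : rename.

Section linear_algebra.
Context {R : realType}.

Definition is_subspace (E : lmodType R) (A : set E) : Prop :=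
  A 0 /\ forall (a : R) x y, A x -> A y -> A (a *: x + y).

Record subspace (E : lmodType R) := Subspace {
  subspace_set :> E -> Prop;
  subspaceP : is_subspace subspace_set
}.

Section subspace_theory.
Context {E : lmodType R} (W : subspace E).

Lemma subspace0 : W 0. Proof. exact: (subspaceP W).1. Qed.

Lemma subspaceD x y : W x -> W y -> W (x + y).
Proof. by move=> Wx Wy; rewrite -[x]scale1r; exact: (subspaceP W).2. Qed.

Lemma subspaceZ a x : W x -> W (a *: x).
Proof.
by move=> Wx; rewrite -[_ *: _]addr0; apply: (subspaceP W).2 => //; exact: subspace0.
Qed.

Lemma subspaceN x : W x -> W (- x).
Proof. by move=> Wx; rewrite -scaleN1r; exact: subspaceZ. Qed.

Lemma subspaceB x y : W x -> W y -> W (x - y).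
Proof. by move=> Wx Wy; apply: subspaceD => //; exact: subspaceN. Qed.

Lemma subspace_sum I (r : seq I) (P : pred I) (F : I -> E) :
  (forall i, P i -> W (F i)) -> W (\sum_(i <- r | P i) F i).
Proof. by move=> WF; elim/big_ind: _ => //; [exact: subspace0|exact: subspaceD]. Qed.

End subspace_theory.

Section span.
Context {E : lmodType R} (S : set E).

Definition span_set : set E :=
  [set x | forall W : subspace E, S `<=` W -> W x].

Fact span_subproof : is_subspace span_set.
Proof.
split=> [W _|a x y Sx Sy W SW]; first exact: subspace0.
by apply: (subspaceP W).2; [exact: Sx|exact: Sy].
Qed.

Definition lin_span : subspace E := Subspace span_subproof.

Lemma lin_span_sub : S `<=` lin_span.
Proof. by move=> x Sx W; apply. Qed.

Lemma lin_span_min (W : subspace E) : S `<=` W -> lin_span `<=` W.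
Proof. by move=> SW x; apply. Qed.

End span.

Section preimage.
Context {E F : lmodType R} (f : {linear E -> F}).

Fact preim_subspace_subproof (W : subspace F) : is_subspace (f @^-1` W).
Proof.
split=> [|a x y] /=; first by rewrite linear0; exact: subspace0.
by rewrite linearP; exact: (subspaceP W).2.
Qed.
Definition preim_subspace W := Subspace (preim_subspace_subproof W).

Fact range_subspace_subproof : is_subspace (range f).
Proof.
split=> [|a _ _ [x _ <-] [y _ <-]]; first by exists 0; rewrite ?linear0.
by exists (a *: x + y); rewrite // linearP.
Qed.
Definition range_subspace := Subspace range_subspace_subproof.

End preimage.

Section quotient_space.
Context {E : lmodType R} (W : subspace E).

Definition subspace_pred : {pred E} := [pred x | `[< W x >]].

Fact subspace_pred_zmod : zmod_closed subspace_pred.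
Proof.
split; first by apply/asboolP; exact: subspace0.
by move=> x y /asboolP Wx /asboolP Wy; apply/asboolP; exact: subspaceB.
Qed.
HB.instance Definition _ := GRing.isZmodClosed.Build E subspace_pred subspace_pred_zmod.

Definition vquot : Type := {ideal_quot subspace_pred}.
HB.instance Definition _ := GRing.Zmodule.on vquot.
HB.instance Definition _ := Quotient.on vquot.

Definition vquot_pi (x : E) : vquot := \pi_vquot x.

Lemma vquot_piE x y : vquot_pi x = vquot_pi y <-> W (x - y).
Proof.
have H := Quotient.idealrBE subspace_pred x y.
split=> [/eqP e|/asboolP e].
  by apply/asboolP; move: H; rewrite -[in X in _ = X]/(vquot_pi x == vquot_pi y) e.
by apply/eqP; move: H; rewrite -[in X in _ = X]/(vquot_pi x == vquot_pi y) => <-.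
Qed.

Lemma vquot_surj (y : vquot) : exists x, vquot_pi x = y.
Proof. by exists (repr y); rewrite /vquot_pi reprK. Qed.

Definition vquot_scale (a : R) (x : vquot) : vquot := vquot_pi (a *: repr x).

Fact vquot_piZ a x : vquot_pi (a *: x) = vquot_scale a (vquot_pi x).
Proof.
apply/vquot_piE; rewrite -scalerBr; apply: subspaceZ.
by apply/vquot_piE; rewrite /vquot_pi reprK.
Qed.

Fact vquot_piB x y : vquot_pi (x - y) = vquot_pi x - vquot_pi y.
Proof. exact: (raddfB \pi_{ideal_quot subspace_pred}). Qed.

Fact vquot_piD x y : vquot_pi (x + y) = vquot_pi x + vquot_pi y.
Proof. exact: (raddfD \pi_{ideal_quot subspace_pred}). Qed.

Fact vquot_scaleA a b x :
  vquot_scale a (vquot_scale b x) = vquot_scale (a * b) x.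
Proof. by case: (vquot_surj x) => y <-; rewrite -!vquot_piZ scalerA. Qed.

Fact vquot_scale1 : left_id 1 vquot_scale.
Proof. by move=> x; case: (vquot_surj x) => y <-; rewrite -vquot_piZ scale1r. Qed.

Fact vquot_scaleDr : right_distributive vquot_scale +%R.
Proof.
move=> a x y; case: (vquot_surj x) (vquot_surj y) => [x' <-] [y' <-].
by rewrite -!(vquot_piD, vquot_piZ) scalerDr.
Qed.

Fact vquot_scaleDl x : {morph vquot_scale^~ x : a b / a + b}.
Proof.
move=> a b /=; case: (vquot_surj x) => x' <-.
by rewrite -!vquot_piZ -vquot_piD scalerDl.
Qed.

HB.instance Definition _ := GRing.Zmodule_isLmodule.Build R vquot
  vquot_scaleA vquot_scale1 vquot_scaleDr vquot_scaleDl.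

Fact vquot_pi_linear : linear vquot_pi.
Proof. by move=> a x y; rewrite vquot_piD vquot_piZ. Qed.
HB.instance Definition _ := GRing.isLinear.Build R E vquot _ vquot_pi vquot_pi_linear.

Lemma vquot_pi0 x : vquot_pi x = 0 <-> W x.
Proof. by rewrite -(linear0 vquot_pi) vquot_piE subr0. Qed.

End quotient_space.

Section free_space.
Context {X : choiceType}.

(* the vector space of finite formal linear combinations of elements of X *)
Definition free_space : lmodType R := (malg X R : Type).

Definition fgen (x : X) : free_space := mkmalgU x 1.

Definition free_lift (E : lmodType R) (f : X -> E) (u : free_space) : E :=
  \sum_(x <- msupp u) mcoeff x u *: f x.

Lemma free_liftEw (E : lmodType R) (f : X -> E) (u : free_space)
    (d : {fset X}%fset) : (msupp u `<=` d)%fset ->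
  free_lift f u = \sum_(x <- d) mcoeff x u *: f x.
Proof.
move=> ud; rewrite /free_lift; apply: big_fset_incl => // x _ xu.
by rewrite mcoeff_outdom ?scale0r.
Qed.

Fact free_lift_linear (E : lmodType R) (f : X -> E) : linear (free_lift f).
Proof.
move=> a u v; pose d := (msupp u `|` msupp v)%fset.
rewrite (@free_liftEw _ _ u d) ?fsubsetUl // (@free_liftEw _ _ v d) ?fsubsetUr //.
rewrite (@free_liftEw _ _ (a *: u + v) d).
  rewrite scaler_sumr -big_split /=; apply: eq_bigr => x _.
  by rewrite mcoeffD mcoeffZ scalerDl scalerA.
apply: fsubset_trans (msuppD_le _ _) _.
by apply: fsetSU; exact: msuppZ_le.
Qed.
HB.instance Definition _ (E : lmodType R) (f : X -> E) :=
  GRing.isLinear.Build R free_space E _ (free_lift f) (free_lift_linear f).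

Lemma free_lift_gen (E : lmodType R) (f : X -> E) x : free_lift f (fgen x) = f x.
Proof.
rewrite (@free_liftEw _ f _ [fset x]%fset) ?msuppU_le //.
by rewrite big_seq_fset1 mcoeffUU scale1r.
Qed.

Lemma free_lift_comb (E : lmodType R) (f g h : X -> E) a u :
  free_lift f u - (a *: free_lift g u + free_lift h u) =
  free_lift (fun x => f x - (a *: g x + h x)) u.
Proof.
rewrite /free_lift scaler_sumr -big_split -sumrB /=; apply: eq_bigr => x _.
by rewrite scalerBr scalerDr !scalerA mulrC.
Qed.

Lemma free_lift_in (E : lmodType R) (W : subspace E) (f : X -> E) u :
  (forall x, W (f x)) -> W (free_lift f u).
Proof. by move=> Wf; apply: subspace_sum => x _; exact: subspaceZ. Qed.

Lemma free_spaceE (u : free_space) : u = \sum_(x <- msupp u) mcoeff x u *: fgen x.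
Proof.
rewrite [LHS]monalgE; apply: eq_bigr => x _.
by apply/malgP => y; rewrite mcoeffZ !mcoeffU mulr_natr.
Qed.

Lemma free_ind (W : subspace free_space) : (forall x, W (fgen x)) -> forall u, W u.
Proof.
by move=> Wg u; rewrite (free_spaceE u); exact: (free_lift_in (f := fgen)).
Qed.

Lemma fgen_neq0 x : fgen x <> 0.
Proof. by move=> /eqP; rewrite monalgU_eq0 oner_eq0. Qed.

End free_space.

End linear_algebra.
Arguments free_space R X : clear implicits.
Arguments fgen {R X}.

Section direct_sum.
Context {R : realType} (T : nat -> lmodType R).

(* external direct sum: families that vanish from some index on *)
Record dsum := Dsum {
  dsum_val :> forall k, T k;
  dsum_subproof : exists N, forall k, (N <= k)%N -> dsum_val k = 0
}.

Lemma dsumP (x y : dsum) : (forall k, x k = y k) -> x = y.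
Proof.
case: x y => [x xP] [y yP] /= xy.
have e : x = y by exact: functional_extensionality_dep.
by case: _ / e yP {xy} => yP; congr Dsum; exact: Prop_irrelevance.
Qed.

HB.instance Definition _ := gen_eqMixin dsum.
HB.instance Definition _ := gen_choiceMixin dsum.

Fact dsum_zero_subproof : exists N, forall k, (N <= k)%N -> (0 : T k) = 0.
Proof. by exists 0%N. Qed.
Definition dsum_zero := Dsum dsum_zero_subproof.

Fact dsum_opp_subproof (x : dsum) : exists N, forall k, (N <= k)%N -> - x k = 0.
Proof. by have [N xN] := dsum_subproof x; exists N => k /xN ->; rewrite oppr0. Qed.
Definition dsum_opp x := Dsum (dsum_opp_subproof x).

Fact dsum_add_subproof (x y : dsum) :
  exists N, forall k, (N <= k)%N -> x k + y k = 0.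
Proof.
have [N xN] := dsum_subproof x; have [M yM] := dsum_subproof y.
exists (maxn N M) => k; rewrite geq_max => /andP[/xN -> /yM ->].
exact: addr0.
Qed.
Definition dsum_add x y := Dsum (dsum_add_subproof x y).

Fact dsum_scale_subproof a (x : dsum) :
  exists N, forall k, (N <= k)%N -> a *: x k = 0.
Proof. by have [N xN] := dsum_subproof x; exists N => k /xN ->; rewrite scaler0. Qed.
Definition dsum_scale a x := Dsum (dsum_scale_subproof a x).

Fact dsum_addA : associative dsum_add.
Proof. by move=> x y z; apply: dsumP => k /=; rewrite addrA. Qed.
Fact dsum_addC : commutative dsum_add.
Proof. by move=> x y; apply: dsumP => k /=; rewrite addrC. Qed.
Fact dsum_add0 : left_id dsum_zero dsum_add.
Proof. by move=> x; apply: dsumP => k /=; rewrite add0r. Qed.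
Fact dsum_addN : left_inverse dsum_zero dsum_opp dsum_add.
Proof. by move=> x; apply: dsumP => k /=; rewrite addNr. Qed.
HB.instance Definition _ :=
  GRing.isZmodule.Build dsum dsum_addA dsum_addC dsum_add0 dsum_addN.

Fact dsum_scaleA a b x : dsum_scale a (dsum_scale b x) = dsum_scale (a * b) x.
Proof. by apply: dsumP => k /=; rewrite scalerA. Qed.
Fact dsum_scale1 : left_id 1 dsum_scale.
Proof. by move=> x; apply: dsumP => k /=; rewrite scale1r. Qed.
Fact dsum_scaleDr : right_distributive dsum_scale +%R.
Proof. by move=> a x y; apply: dsumP => k /=; rewrite scalerDr. Qed.
Fact dsum_scaleDl x : {morph dsum_scale^~ x : a b / a + b}.
Proof. by move=> a b; apply: dsumP => k /=; rewrite scalerDl. Qed.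
HB.instance Definition _ := GRing.Zmodule_isLmodule.Build R dsum
  dsum_scaleA dsum_scale1 dsum_scaleDr dsum_scaleDl.

(* the l-th component of the image of x in the direct sum *)
Definition dsum_comp k (x : T k) l : T l :=
  if eqP is ReflectT e then ecast i (T i) e x else 0 : T l.

Lemma dsum_comp_id k (x : T k) : dsum_comp x k = x.
Proof.
by rewrite /dsum_comp; case: eqP => // e; rewrite (eq_axiomK e).
Qed.

Lemma dsum_comp_ne k (x : T k) l : k != l -> dsum_comp x l = 0.
Proof. by rewrite /dsum_comp; case: eqP. Qed.

Fact dsum_inj_subproof k (x : T k) :
  exists N, forall l, (N <= l)%N -> dsum_comp x l = 0.
Proof. by exists k.+1 => l kl; rewrite dsum_comp_ne // neq_ltn kl. Qed.
Definition dsum_inj k (x : T k) : dsum := Dsum (dsum_inj_subproof x).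

Fact dsum_inj_linear k : linear (@dsum_inj k).
Proof.
move=> a x y; apply: dsumP => l /=.
have [kl|kl] := eqVneq k l; last by rewrite !dsum_comp_ne // scaler0 addr0.
by case: _ / kl; rewrite !dsum_comp_id.
Qed.
HB.instance Definition _ k :=
  GRing.isLinear.Build R (T k) dsum _ (@dsum_inj k) (@dsum_inj_linear k).

Definition dsum_bound (x : dsum) : nat := sval (cid (dsum_subproof x)).

Lemma dsum_boundP (x : dsum) k : (dsum_bound x <= k)%N -> x k = 0.
Proof. exact: (svalP (cid (dsum_subproof x))). Qed.

Lemma dsum_sumE N (F : nat -> dsum) k : (\sum_(l < N) F l) k = \sum_(l < N) F l k.
Proof. by elim: N => [|N IH]; rewrite ?big_ord0 // !big_ord_recr /= IH. Qed.

Lemma dsumE (x : dsum) N : (dsum_bound x <= N)%N ->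
  x = \sum_(k < N) dsum_inj (x k).
Proof.
move=> xN; apply: dsumP => k; rewrite (dsum_sumE N (fun k => dsum_inj (x k))).
have [kN|Nk] := ltnP k N.
  rewrite (bigD1 (Ordinal kN)) //= dsum_comp_id big1 ?addr0 // => i ik.
  by rewrite dsum_comp_ne.
rewrite dsum_boundP ?(leq_trans xN) // big1 // => i _ /=.
by rewrite dsum_comp_ne // neq_ltn (leq_trans (ltn_ord i)).
Qed.

End direct_sum.

Section direct_sum_diffeology.
Context {R : realType} {T : nat -> lmodType R}.
Context (D : forall k, diffeology R (T k)).

Definition dsum_plot n (U : set 'rV[R]_n) (p : 'rV[R]_n -> dsum T) :=
  open U /\ forall x, U x ->
  exists (W : set 'rV[R]_n) (N : nat) (q : forall k, 'rV[R]_n -> T k),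
    [/\ open W /\ W x, W `<=` U, forall k, (k < N)%N -> plot (D k) W (q k)
      & forall y, W y -> p y = \sum_(k < N) dsum_inj (q k y)].

Program Definition dsum_diffeology : diffeology R (dsum T) :=
  @Diffeology _ _ dsum_plot _ _ _ _.
Next Obligation. by move=> n U p []. Qed.
Next Obligation.
move=> n U z oU; split=> // x Ux; exists U, (dsum_bound z), (fun k _ => z k).
by split=> // [k _|y _]; [exact: plot_cst|exact: dsumE].
Qed.
Next Obligation.
move=> m n U W h p oU UW sh [oW Wp]; split=> // x Ux.
have [W' [N [q [[oW' W'x] W'W Dq pq]]]] := Wp _ (UW _ Ux).
exists (U `&` h @^-1` W'), N, (fun k => q k \o h).
have oUW : open (U `&` h @^-1` W') by exact: smooth_preim_open sh.
split=> //.
- move=> k kN; apply: (plot_comp _ _ _ (Dq k kN)) => //; first by move=> y [].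
  by apply: smooth_on_sub sh => y [].
- by move=> y [Uy W'hy] /=; rewrite pq.
Qed.
Next Obligation.
move=> n U p oU Up; split=> // x Ux; have [W [q [Wx WU [oW Wq] pq]]] := Up _ Ux.
have [W' [N [r [oW' W'W Dr qr]]]] := Wq _ Wx.
exists W', N, r; split=> //; first exact: subset_trans W'W WU.
by move=> y W'y; rewrite pq ?qr //; exact: W'W.
Qed.

End direct_sum_diffeology.

Section tensor_algebra.
Context {R : realType}.

Section definitions.
Context (V : lmodType R).

(* The k-fold tensor power is the quotient of the free vector space on the
   product set V^k by the multilinearity relations. For k = 0 there are no
   relations and V^0 is a point, so the quotient is a line. *)
Definition multilinear_rel k : set (free_space R (k.-tuple V)) :=
  [set u | exists (s1 s2 : seq V) (a : R) (v w : V) (t t1 t2 : k.-tuple V),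
    [/\ tval t = s1 ++ (a *: v + w) :: s2, tval t1 = s1 ++ v :: s2,
        tval t2 = s1 ++ w :: s2
      & u = fgen t - (a *: fgen t1 + fgen t2)]].

Definition tensor_power k : lmodType R := vquot (lin_span (@multilinear_rel k)).

Definition tensor k (t : k.-tuple V) : tensor_power k := vquot_pi _ (fgen t).

Definition cat_free k l (u : free_space R (k.-tuple V))
    (v : free_space R (l.-tuple V)) : free_space R ((k + l).-tuple V) :=
  free_lift (fun s => free_lift (fun t => fgen (cat_tuple s t)) v) u.

Definition tensor_mul k l (x : tensor_power k) (y : tensor_power l) :
    tensor_power (k + l) :=
  vquot_pi _ (cat_free (repr x) (repr y)).

Definition tensor_algebra : Type := dsum tensor_power.
HB.instance Definition _ := GRing.Lmodule.on tensor_algebra.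

Definition tensor_in k (x : tensor_power k) : tensor_algebra := dsum_inj x.
HB.instance Definition _ k :=
  GRing.isLinear.Build R (tensor_power k) tensor_algebra _ (@tensor_in k)
    (@dsum_inj_linear _ tensor_power k).

(* word [:: v_1; ...; v_k] is the element v_1 (x) ... (x) v_k of T(V) *)
Definition word (s : seq V) : tensor_algebra := tensor_in (tensor (in_tuple s)).

(* The sums over all k and l; only finitely many terms are nonzero, see
   [talg_mulE]. *)
Definition talg_mul (x y : tensor_algebra) : tensor_algebra :=
  \sum_(k < dsum_bound x) \sum_(l < dsum_bound y)
     tensor_in (tensor_mul (dsum_val x k) (dsum_val y l)).

End definitions.

Section theory.
Context {V : lmodType R}.
Local Notation T := (tensor_algebra V).
Local Notation N k := (lin_span (@multilinear_rel V k)).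

Lemma linearB_prop (E F : lmodType R) (f : E -> F) :
  linear f -> {morph f : x y / x - y}.
Proof.
move=> lf x y; have := lf (-1) y x.
by rewrite !scaleN1r ![- _ + _]addrC.
Qed.

Lemma linear0_prop (E F : lmodType R) (f : E -> F) : linear f -> f 0 = 0.
Proof. by move=> lf; rewrite -(subrr 0) (linearB_prop lf) subrr. Qed.

Lemma linearZ_prop (E F : lmodType R) (f : E -> F) a x :
  linear f -> f (a *: x) = a *: f x.
Proof. by move=> lf; rewrite -[_ *: _]addr0 lf (linear0_prop lf) addr0. Qed.

Lemma multilinear_rel_lift k (E : lmodType R) (W : subspace E) (f : k.-tuple V -> E) :
  (forall s1 s2 a v w (t t1 t2 : k.-tuple V),
     tval t = s1 ++ (a *: v + w) :: s2 -> tval t1 = s1 ++ v :: s2 ->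
     tval t2 = s1 ++ w :: s2 -> W (f t - (a *: f t1 + f t2))) ->
  forall u, N k u -> W (free_lift f u).
Proof.
move=> Wf; apply: (@lin_span_min _ _ _ (preim_subspace (free_lift f) W)).
move=> _ [s1 [s2 [a [v [w [t [t1 [t2 [ts t1s t2s ->]]]]]]]]] /=.
rewrite linearB linearP /= !free_lift_gen; exact: Wf ts t1s t2s.
Qed.

Lemma cat_freeDl k l (v : free_space R (l.-tuple V)) :
  linear (fun u : free_space R (k.-tuple V) => cat_free u v).
Proof. exact: linearP. Qed.

Lemma cat_freeDr k l (u : free_space R (k.-tuple V)) :
  linear (fun v : free_space R (l.-tuple V) => cat_free u v).
Proof.
move=> a v w; rewrite /cat_free {1 3 5}/free_lift scaler_sumr -big_split /=.
apply: eq_bigr => s _.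
by rewrite linearP scalerDr !scalerA [a * _]mulrC.
Qed.

Lemma cat_free_gen k l (s : k.-tuple V) (t : l.-tuple V) :
  cat_free (fgen s) (fgen t) = fgen (cat_tuple s t).
Proof. by rewrite /cat_free !free_lift_gen. Qed.

Lemma cat_free_rell k l u (v : free_space R (l.-tuple V)) :
  N k u -> N (k + l) (cat_free u v).
Proof.
apply: multilinear_rel_lift => s1 s2 a x y t t1 t2 ts t1s t2s.
rewrite free_lift_comb; apply: free_lift_in => r.
apply: lin_span_sub; exists s1, (s2 ++ r), a, x, y.
exists (cat_tuple t r), (cat_tuple t1 r), (cat_tuple t2 r).
by split=> //=; rewrite ?ts ?t1s ?t2s -catA.
Qed.

Lemma cat_free_relr k l (u : free_space R (k.-tuple V)) v :
  N l v -> N (k + l) (cat_free u v).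
Proof.
move=> Nv; apply: free_lift_in => s; move: v Nv.
apply: multilinear_rel_lift => s1 s2 a x y t t1 t2 ts t1s t2s.
apply: lin_span_sub; exists (s ++ s1), s2, a, x, y.
exists (cat_tuple s t), (cat_tuple s t1), (cat_tuple s t2).
by split=> //=; rewrite ?ts ?t1s ?t2s catA.
Qed.

Lemma tensor_mul_pi k l (u : free_space R (k.-tuple V))
    (v : free_space R (l.-tuple V)) :
  tensor_mul (vquot_pi _ u) (vquot_pi _ v) = vquot_pi _ (cat_free u v).
Proof.
apply/vquot_piE; set u' := repr _; set v' := repr _.
have Nu : N k (u' - u) by apply/vquot_piE; rewrite /vquot_pi reprK.
have Nv : N l (v' - v) by apply/vquot_piE; rewrite /vquot_pi reprK.
have -> : cat_free u' v' - cat_free u v =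
    cat_free (u' - u) v' + cat_free u (v' - v).
  rewrite (linearB_prop (cat_freeDl v')) (linearB_prop (cat_freeDr u)).
  by rewrite addrA subrK.
by apply: subspaceD; [exact: cat_free_rell|exact: cat_free_relr].
Qed.

Lemma tensor_mul_tensor k l (s : k.-tuple V) (t : l.-tuple V) :
  tensor_mul (tensor s) (tensor t) = tensor (cat_tuple s t).
Proof. by rewrite tensor_mul_pi cat_free_gen. Qed.

Lemma tensor_mulDl k l (y : tensor_power V l) :
  linear (fun x : tensor_power V k => tensor_mul x y).
Proof.
move=> a x1 x2; have [v <-] := vquot_surj y.
have [u1 <-] := vquot_surj x1; have [u2 <-] := vquot_surj x2.
by rewrite -linearP !tensor_mul_pi cat_freeDl linearP.
Qed.

Lemma tensor_mulDr k l (x : tensor_power V k) :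
  linear (fun y : tensor_power V l => tensor_mul x y).
Proof.
move=> a y1 y2; have [v <-] := vquot_surj x.
have [u1 <-] := vquot_surj y1; have [u2 <-] := vquot_surj y2.
by rewrite -linearP !tensor_mul_pi cat_freeDr linearP.
Qed.

Lemma tensor_mul0l k l (y : tensor_power V l) :
  tensor_mul (0 : tensor_power V k) y = 0.
Proof. exact: linear0_prop (tensor_mulDl y). Qed.

Lemma tensor_mul0r k l (x : tensor_power V k) :
  tensor_mul x (0 : tensor_power V l) = 0.
Proof. exact: linear0_prop (tensor_mulDr x). Qed.

Lemma tensor_in_tensor k (t : k.-tuple V) : tensor_in (tensor t) = word t.
Proof.
case: t => s sz; have e := elimT eqP sz; case: _ / e sz => sz.
by congr (tensor_in (tensor _)); exact: val_inj.
Qed.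

Lemma talg_ind (W : subspace T) : (forall s, W (word s)) -> forall x, W x.
Proof.
move=> Ww x; rewrite (dsumE (leqnn (dsum_bound x))).
apply: subspace_sum => k _; have [u <-] := vquot_surj (dsum_val x k).
rewrite -/(tensor_in (vquot_pi _ u)) (free_spaceE u) !linear_sum /=.
apply: subspace_sum => t _; rewrite !linearZ /=; apply: subspaceZ.
rewrite -/(tensor t) tensor_in_tensor; exact: Ww.
Qed.

Lemma talg_ext (E : lmodType R) (f g : T -> E) : linear f -> linear g ->
  (forall s, f (word s) = g (word s)) -> f =1 g.
Proof.
move=> lf lg fg.
have W0 : is_subspace [set x | f x = g x].
  split=> [|a x y /= fx fy]; last by rewrite lf lg fx fy.
  by rewrite /= (linear0_prop lf) (linear0_prop lg).
exact: (@talg_ind (Subspace W0) fg).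
Qed.

Lemma talg_mulE (x y : T) K L : (dsum_bound x <= K)%N -> (dsum_bound y <= L)%N ->
  talg_mul x y = \sum_(k < K) \sum_(l < L)
    tensor_in (tensor_mul (dsum_val x k) (dsum_val y l)).
Proof.
have widen : forall (F : nat -> T) n m, (n <= m)%N ->
    (forall k, (n <= k)%N -> F k = 0) -> \sum_(k < n) F k = \sum_(k < m) F k.
  move=> F n; elim=> [|m IH]; first by rewrite leqn0 => /eqP ->.
  rewrite leq_eqVlt => /predU1P[->//|nm] F0.
  by rewrite big_ord_recr /= -IH // F0 // addr0.
move=> xK yL; rewrite /talg_mul.
transitivity (\sum_(k < dsum_bound x) \sum_(l < L)
    tensor_in (tensor_mul (dsum_val x k) (dsum_val y l))).
  apply: eq_bigr => k _.
  apply: (widen (fun l => tensor_in (tensor_mul (dsum_val x k) (dsum_val y l)))) => // l yl.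
  by rewrite (dsum_boundP yl) tensor_mul0r linear0.
apply: (widen (fun k => \sum_(l < L) tensor_in (tensor_mul (dsum_val x k) (dsum_val y l)))) => // k xk.
by apply: big1 => l _; rewrite (dsum_boundP xk) tensor_mul0l linear0.
Qed.

Lemma talg_mulDl (y : T) : linear (fun x : T => talg_mul x y).
Proof.
move=> a x1 x2.
pose K := maxn (dsum_bound (a *: x1 + x2)) (maxn (dsum_bound x1) (dsum_bound x2)).
rewrite !(@talg_mulE _ _ K (dsum_bound y)) ?leq_max ?leqnn ?orbT //.
rewrite scaler_sumr -big_split /=; apply: eq_bigr => k _.
rewrite scaler_sumr -big_split /=; apply: eq_bigr => l _.
by rewrite -linearP -tensor_mulDl.
Qed.

Lemma talg_mulDr (x : T) : linear (fun y : T => talg_mul x y).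
Proof.
move=> a x1 x2.
pose K := maxn (dsum_bound (a *: x1 + x2)) (maxn (dsum_bound x1) (dsum_bound x2)).
rewrite !(@talg_mulE _ _ (dsum_bound x) K) ?leq_max ?leqnn ?orbT //.
rewrite scaler_sumr -big_split /=; apply: eq_bigr => k _.
rewrite scaler_sumr -big_split /=; apply: eq_bigr => l _.
by rewrite -linearP -tensor_mulDr.
Qed.

Lemma talg_mul_in k l (x : tensor_power V k) (y : tensor_power V l) :
  talg_mul (tensor_in x) (tensor_in y) = tensor_in (tensor_mul x y).
Proof.
pose K := maxn (dsum_bound (tensor_in x)) k.+1.
pose L := maxn (dsum_bound (tensor_in y)) l.+1.
have kK : (k < K)%N by rewrite leq_max leqnn orbT.
have lL : (l < L)%N by rewrite leq_max leqnn orbT.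
rewrite (@talg_mulE _ _ K L) ?leq_max ?leqnn //.
rewrite (bigD1 (Ordinal kK)) //= (bigD1 (Ordinal lL)) //=.
rewrite !dsum_comp_id !big1 ?addr0 // => [i ik|i il].
  by apply: big1 => j _; rewrite dsum_comp_ne ?tensor_mul0l ?linear0 // eq_sym.
by rewrite (@dsum_comp_ne _ _ l) ?tensor_mul0r ?linear0 // eq_sym.
Qed.

Lemma talg_mul_word (s t : seq V) : talg_mul (word s) (word t) = word (s ++ t).
Proof. by rewrite talg_mul_in tensor_mul_tensor tensor_in_tensor. Qed.

Fact talg_mulA : associative (@talg_mul V).
Proof.
move=> x y z; move: x; apply: talg_ext => [a x1 x2|a x1 x2|s].
- by rewrite talg_mulDl.
- by rewrite !talg_mulDl.
move: y; apply: talg_ext => [a x1 x2|a x1 x2|t].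
- by rewrite talg_mulDl talg_mulDr.
- by rewrite talg_mulDr talg_mulDl.
move: z; apply: talg_ext => [a x1 x2|a x1 x2|u].
- by rewrite !talg_mulDr.
- by rewrite talg_mulDr.
by rewrite !talg_mul_word catA.
Qed.

Fact talg_mul1 : left_id (word [::]) (@talg_mul V).
Proof.
by apply: talg_ext => // [|s]; [exact: talg_mulDr|rewrite talg_mul_word].
Qed.

Fact talg_mulr1 : right_id (word [::]) (@talg_mul V).
Proof.
by apply: talg_ext => // [|s]; [exact: talg_mulDl|rewrite talg_mul_word cats0].
Qed.

Fact talg_mul_addl : left_distributive (@talg_mul V) +%R.
Proof. by move=> x y z; have := talg_mulDl z 1 x y; rewrite !scale1r. Qed.

Fact talg_mul_addr : right_distributive (@talg_mul V) +%R.
Proof. by move=> x y z; have := talg_mulDr x 1 y z; rewrite !scale1r. Qed.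

Fact talg_one_neq0 : word [::] != 0 :> T.
Proof.
apply/eqP => /(congr1 (fun x : T => dsum_val x 0%N)) /=.
rewrite dsum_comp_id => /vquot_pi0.
have W0 : is_subspace [set 0 : free_space R (0.-tuple V)].
  by split=> // a x y /= -> ->; rewrite scaler0 addr0.
move=> /(_ (Subspace W0)) H; apply: (fgen_neq0 (H _)).
move=> u [s1 [s2 [a [v [w [t [t1 [t2 [ts _ _ _]]]]]]]]].
by have := size_tuple t; rewrite ts size_cat addnS.
Qed.

HB.instance Definition _ := GRing.Zmodule_isNzRing.Build T
  talg_mulA talg_mul1 talg_mulr1 talg_mul_addl talg_mul_addr talg_one_neq0.

Lemma wordM (s t : seq V) : word s * word t = word (s ++ t) :> T.
Proof. exact: talg_mul_word. Qed.

Fact talg_scaleAl (a : R) (x y : T) : a *: (x * y) = (a *: x) * y.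
Proof.
exact: esym (linearZ_prop a x (talg_mulDl y)).
Qed.
HB.instance Definition _ := GRing.Lmodule_isLalgebra.Build R T talg_scaleAl.

Fact talg_scaleAr (a : R) (x y : T) : a *: (x * y) = x * (a *: y).
Proof.
exact: esym (linearZ_prop a y (talg_mulDr x)).
Qed.
HB.instance Definition _ := GRing.Lalgebra_isAlgebra.Build R T talg_scaleAr.

End theory.
End tensor_algebra.

Section clifford_algebra.
Context {R : realType}.

Section ideal.
Context {A : algType R}.

(* two-sided ideals *)
Definition is_ideal (I : set A) : Prop :=
  is_subspace I /\ forall a x, I x -> I (a * x) /\ I (x * a).

Definition ideal_set (S : set A) : set A :=
  [set x | forall I, is_ideal I -> S `<=` I -> I x].

Fact ideal_set_subproof (S : set A) : is_subspace (ideal_set S).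
Proof.
split=> [I [[]]//|a x y Sx Sy I iI SI].
by apply: iI.1.2; [exact: Sx|exact: Sy].
Qed.

Definition ideal_gen (S : set A) : subspace A := Subspace (ideal_set_subproof S).

Lemma ideal_gen_sub (S : set A) : S `<=` ideal_gen S.
Proof. by move=> x Sx I _; apply. Qed.

Lemma ideal_gen_ideal (S : set A) : is_ideal (ideal_gen S).
Proof.
split; first exact: subspaceP.
by move=> a x Sx; split=> I iI SI;
  [apply: (iI.2 a x _).1|apply: (iI.2 a x _).2]; exact: Sx.
Qed.

End ideal.

Section definitions.
Context {V : lmodType R} (q : V -> V -> R).
Local Notation T := (tensor_algebra V).

Definition vec (v : V) : T := word [:: v].

Definition clifford_rel : set T :=
  [set x | exists v w, x = vec v * vec w + vec w * vec v + (4%:R * q v w)%:A].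

Definition clifford_ideal : subspace T := ideal_gen clifford_rel.

Definition clifford : Type := vquot clifford_ideal.
HB.instance Definition _ := GRing.Lmodule.on clifford.
HB.instance Definition _ := Quotient.on clifford.

Definition clifford_pi (x : T) : clifford := vquot_pi _ x.
HB.instance Definition _ := GRing.isLinear.Build R T clifford _ clifford_pi
  (@vquot_pi_linear _ _ clifford_ideal).

Lemma clifford_surj (y : clifford) : exists x, clifford_pi x = y.
Proof. exact: vquot_surj. Qed.

Lemma clifford_piE x y :
  clifford_pi x = clifford_pi y <-> clifford_ideal (x - y).
Proof. exact: vquot_piE. Qed.

Definition clifford_mul (x y : clifford) : clifford :=
  clifford_pi (repr x * repr y).

Fact clifford_piM x y :
  clifford_pi (x * y) = clifford_mul (clifford_pi x) (clifford_pi y).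
Proof.
apply/clifford_piE; set x' := repr _; set y' := repr _.
have Ix : clifford_ideal (x - x') by apply/clifford_piE; rewrite /clifford_pi /vquot_pi reprK.
have Iy : clifford_ideal (y - y') by apply/clifford_piE; rewrite /clifford_pi /vquot_pi reprK.
have -> : x * y - x' * y' = (x - x') * y + x' * (y - y').
  by rewrite mulrBl mulrBr addrA subrK.
have [_ iM] := ideal_gen_ideal clifford_rel.
by apply: subspaceD; [exact: (iM _ _ Ix).2|exact: (iM _ _ Iy).1].
Qed.

Fact clifford_mulA : associative clifford_mul.
Proof.
move=> x y z; have [x' <-] := clifford_surj x; have [y' <-] := clifford_surj y.
by have [z' <-] := clifford_surj z; rewrite -!clifford_piM mulrA.
Qed.
Fact clifford_mul1 : left_id (clifford_pi 1) clifford_mul.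
Proof. by move=> x; have [x' <-] := clifford_surj x; rewrite -clifford_piM mul1r. Qed.
Fact clifford_mulr1 : right_id (clifford_pi 1) clifford_mul.
Proof. by move=> x; have [x' <-] := clifford_surj x; rewrite -clifford_piM mulr1. Qed.
Fact clifford_mul_addl : left_distributive clifford_mul +%R.
Proof.
move=> x y z; have [x' <-] := clifford_surj x; have [y' <-] := clifford_surj y.
by have [z' <-] := clifford_surj z; rewrite -linearD -!clifford_piM mulrDl linearD.
Qed.
Fact clifford_mul_addr : right_distributive clifford_mul +%R.
Proof.
move=> x y z; have [x' <-] := clifford_surj x; have [y' <-] := clifford_surj y.
by have [z' <-] := clifford_surj z; rewrite -linearD -!clifford_piM mulrDr linearD.
Qed.
HB.instance Definition _ := GRing.Zmodule_isPzRing.Build clifford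
  clifford_mulA clifford_mul1 clifford_mulr1 clifford_mul_addl clifford_mul_addr.

End definitions.

Section functoriality.
Context {V W : lmodType R} (f : {linear V -> W}).

Definition tensor_power_map k (x : tensor_power V k) : tensor_power W k :=
  vquot_pi _ (free_lift (fun t => fgen (map_tuple f t)) (repr x)).

Lemma tensor_power_map_pi k (u : free_space R (k.-tuple V)) :
  tensor_power_map (vquot_pi _ u) =
  vquot_pi _ (free_lift (fun t => fgen (map_tuple f t)) u).
Proof.
apply/vquot_piE; rewrite -linearB.
have : lin_span (@multilinear_rel _ V k) (repr (vquot_pi (lin_span (@multilinear_rel _ V k)) u) - u).
  by apply/vquot_piE; rewrite /vquot_pi reprK.
apply: multilinear_rel_lift => s1 s2 a v w t t1 t2 ts t1s t2s.
apply: lin_span_sub; exists (map f s1), (map f s2), a, (f v), (f w).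
exists (map_tuple f t), (map_tuple f t1), (map_tuple f t2).
by split=> //=; rewrite ?ts ?t1s ?t2s map_cat //= linearP.
Qed.

Fact tensor_power_map_linear k : linear (@tensor_power_map k).
Proof.
move=> a x y; have [x' <-] := vquot_surj x; have [y' <-] := vquot_surj y.
by rewrite -linearP !tensor_power_map_pi !linearP.
Qed.
HB.instance Definition _ k := GRing.isLinear.Build R (tensor_power V k)
  (tensor_power W k) _ (@tensor_power_map k) (@tensor_power_map_linear k).

Lemma tensor_power_map_tensor k (t : k.-tuple V) :
  tensor_power_map (tensor t) = tensor (map_tuple f t).
Proof. by rewrite tensor_power_map_pi free_lift_gen. Qed.

Fact tensor_algebra_map_subproof (x : tensor_algebra V) :
  exists N, forall k, (N <= k)%N -> tensor_power_map (dsum_val x k) = 0.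
Proof. by exists (dsum_bound x) => k xk; rewrite dsum_boundP // linear0. Qed.

Definition tensor_algebra_map (x : tensor_algebra V) : tensor_algebra W :=
  Dsum (tensor_algebra_map_subproof x).

Fact tensor_algebra_map_linear : linear tensor_algebra_map.
Proof. by move=> a x y; apply: dsumP => k; exact: (linearP (@tensor_power_map k)). Qed.
HB.instance Definition _ := GRing.isLinear.Build R (tensor_algebra V)
  (tensor_algebra W) _ tensor_algebra_map tensor_algebra_map_linear.

Lemma tensor_algebra_map_in k (x : tensor_power V k) :
  tensor_algebra_map (tensor_in x) = tensor_in (tensor_power_map x).
Proof.
apply: dsumP => l /=; have [kl|kl] := eqVneq k l.
  by case: _ / kl; rewrite !dsum_comp_id.
by rewrite !dsum_comp_ne // linear0.
Qed.

Lemma tensor_algebra_map_word s : tensor_algebra_map (word s) = word (map f s).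
Proof.
rewrite tensor_algebra_map_in tensor_power_map_tensor tensor_in_tensor.
by [].
Qed.

Fact tensor_algebra_map_monoid : monoid_morphism tensor_algebra_map.
Proof.
split=> [|x y]; first exact: tensor_algebra_map_word.
move: x; apply: talg_ext => [a x1 x2|a x1 x2|s].
- by rewrite mulrDl -scalerAl linearP.
- by rewrite linearP mulrDl scalerAl.
move: y; apply: talg_ext => [a x1 x2|a x1 x2|t].
- by rewrite mulrDr -scalerAr linearP.
- by rewrite linearP mulrDr scalerAr.
by rewrite wordM !tensor_algebra_map_word wordM map_cat.
Qed.
HB.instance Definition _ := GRing.isMonoidMorphism.Build (tensor_algebra V)
  (tensor_algebra W) tensor_algebra_map tensor_algebra_map_monoid.

Context (q : V -> V -> R) (q' : W -> W -> R).

(* The map induced on the quotients, computed on a representative; it is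
   well defined when q' restricts to q along f, see [clifford_map_pi]. *)
Definition clifford_map (x : clifford q) : clifford q' :=
  clifford_pi q' (tensor_algebra_map (repr x)).

Hypothesis qf : forall v w, q' (f v) (f w) = q v w.

Fact tensor_algebra_map_rel v w :
  tensor_algebra_map (vec v * vec w + vec w * vec v + (4%:R * q v w)%:A) =
  vec (f v) * vec (f w) + vec (f w) * vec (f v) + (4%:R * q' (f v) (f w))%:A.
Proof.
have -> : vec v * vec w = word [:: v; w] by exact: wordM.
have -> : vec w * vec v = word [:: w; v] by exact: wordM.
have -> : vec (f v) * vec (f w) = word [:: f v; f w] by exact: wordM.
have -> : vec (f w) * vec (f v) = word [:: f w; f v] by exact: wordM.
have lD x y : tensor_algebra_map (x + y) = tensor_algebra_map x + tensor_algebra_map y.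
  exact: linearD.
rewrite lD lD (linearZ_prop _ _ tensor_algebra_map_linear) qf.
by rewrite !tensor_algebra_map_word.
Qed.

Lemma clifford_map_pi x :
  clifford_map (clifford_pi q x) = clifford_pi q' (tensor_algebra_map x).
Proof.
apply/clifford_piE; rewrite -linearB.
have : clifford_ideal q (repr (clifford_pi q x) - x).
  by apply/clifford_piE; rewrite /clifford_pi /vquot_pi reprK.
have iI : is_ideal [set y | clifford_ideal q' (tensor_algebra_map y)].
  split; first exact: subspaceP (preim_subspace tensor_algebra_map (clifford_ideal q')).
  move=> a y /= Iy; rewrite !rmorphM.
  exact: (ideal_gen_ideal (clifford_rel q')).2.
move=> H; apply: (H _ iI).
move=> _ [v [w ->]]; apply: ideal_gen_sub; exists (f v), (f w).
exact: tensor_algebra_map_rel.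
Qed.

Lemma clifford_map_linear : linear clifford_map.
Proof.
move=> a x y; have [x' <-] := clifford_surj x; have [y' <-] := clifford_surj y.
by rewrite -linearP !clifford_map_pi !linearP.
Qed.

Lemma clifford_map_monoid : monoid_morphism clifford_map.
Proof.
split=> [|x y]; first by rewrite -[1]/(clifford_pi q 1) clifford_map_pi rmorph1.
have [x' <-] := clifford_surj x; have [y' <-] := clifford_surj y.
rewrite -[_ * _ in LHS]/(clifford_mul _ _) -clifford_piM !clifford_map_pi.
by rewrite rmorphM clifford_piM.
Qed.

End functoriality.

Section clifford_diffeology.
Context {V : lmodType R} (D : diffeology R V).

Definition free_diffeology (X : choiceType) (DX : diffeology R X) :
    diffeology R (free_space R X) :=
  finest_vs_diffeology DX (@fgen R X).

Definition tensor_power_diffeology k : diffeology R (tensor_power V k) :=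
  quotient_diffeology (@vquot_surj _ _ (lin_span (@multilinear_rel _ V k)))
    (free_diffeology (power_diffeology D k)).

Definition tensor_algebra_diffeology : diffeology R (tensor_algebra V) :=
  dsum_diffeology tensor_power_diffeology.

Definition clifford_diffeology (q : V -> V -> R) : diffeology R (clifford q) :=
  quotient_diffeology (@clifford_surj V q) tensor_algebra_diffeology.

End clifford_diffeology.

End clifford_algebra.

Section smooth_decomposition.
Context {R : realType} {E : lmodType R} (D : diffeology R E).

Definition add_map (E1 E2 : set E) (x : E1 * E2) : E :=
  set_val x.1 + set_val x.2.

Definition smooth_decomposition (E1 E2 : set E) : Prop :=
  [/\ is_subspace E1, is_subspace E2, bijective (@add_map E1 E2)
    & forall n (U : set 'rV[R]_n) (p : 'rV[R]_n -> E1 * E2),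
        plot (prod_diffeology (subset_diffeology D E1) (subset_diffeology D E2)) U p
        <-> plot D U (@add_map E1 E2 \o p)].

Definition splits_off_smoothly (E1 : set E) : Prop :=
  exists E2 : set E, smooth_decomposition E1 E2.

End smooth_decomposition.

(* f identifies X with a subset of Y carrying the subset diffeology *)
Definition is_induction {R : realType} {X Y : Type} (D : diffeology R X)
    (D' : diffeology R Y) (f : X -> Y) : Prop :=
  injective f /\
  forall n (U : set 'rV[R]_n) p, plot D U p <-> plot D' U (f \o p).

Section vspaces.
Context {R : realType} {V : vectType R}.

(* the set A as a subspace of V, when it is one (otherwise a dummy value) *)
Definition vspace_of (A : set V) : {vspace V} :=
  xget 0%VS [set U : {vspace V} | forall v, v \in U <-> A v].

Lemma memv_vspace_of (W : subspace V) v : v \in vspace_of W <-> W v.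
Proof.
suff [U WU] : exists U : {vspace V}, forall v, v \in U <-> W v.
  by rewrite /vspace_of; case: xgetP => [X _ ->//|/(_ U)].
pose P n := `[< exists2 U : {vspace V}, {subset U <= [pred v | `[< W v >]]} & \dim U = n >].
have exP : exists n, P n.
  exists 0%N; apply/asboolP; exists 0%VS; last exact: dimv0.
  by move=> w; rewrite memv0 => /eqP ->; apply/asboolP; exact: subspace0.
have ubP n : P n -> (n <= \dim {:V})%N.
  by move=> /asboolP[U _ <-]; apply: dimvS; exact: subvf.
case: (ex_maxnP exP ubP) => n /asboolP[U UW dU] maxn.
exists U => w; split=> [/UW/asboolP//|Ww].
have : (U + <[w]> <= U)%VS.
  rewrite -(geq_leqif (dimv_leqif_sup (addvSl U <[w]>))) dU; apply: maxn.
  apply/asboolP; exists (U + <[w]>)%VS => // x.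
  move=> /memv_addP[u /UW/asboolP Wu [_ /vlineP[a ->] ->]].
  by apply/asboolP; apply: subspaceD => //; exact: subspaceZ.
by move/subvP; apply; apply: (subvP (addvSr U <[w]>)); exact: memv_line.
Qed.

Definition vspan (S : set V) : {vspace V} := vspace_of (lin_span S).

End vspaces.

Lemma std_vs_diffeology {R : realType} :
  vs_diffeology (std_diffeology : diffeology R R^o).
Proof.
split=> n U p [[oU p1] [_ p2]]; split=> // k.
  exact: (CkD oU (p1 k) (p2 k)).
exact: (CkM oU (p1 k) (p2 k)).
Qed.

Section pseudo_metrics.
Context {R : realType} {V : vectType R}.

Definition diffeological_dual (D : diffeology R V) : {vspace 'Hom(V, R^o)} :=
  vspace_of [set f : 'Hom(V, R^o) | smooth D std_diffeology (f : V -> R)].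

Lemma diffeological_dualP (D : diffeology R V) (f : 'Hom(V, R^o)) :
  f \in diffeological_dual D <-> smooth D std_diffeology (f : V -> R).
Proof.
have sub : is_subspace [set f : 'Hom(V, R^o) | smooth D std_diffeology (f : V -> R)].
  have [Dadd Dscale] := std_vs_diffeology (R := R).
  split=> [n U p Dp|a f1 f2 s1 s2 n U p Dp].
    have -> : (0 : 'Hom(V, R^o)) \o p = fun=> 0 :> R.
      by apply/funext => x /=; rewrite lfunE.
    exact: (plot_cst std_diffeology 0 (plot_open Dp)).
  have -> : (a *: f1 + f2 : 'Hom(V, R^o)) \o p =
      (fun x => x.1 + x.2) \o (fun x => (a * f1 (p x), f2 (p x))).
    by apply/funext => x /=; rewrite !lfunE /= lfunE.
  apply: Dadd; split; last exact: s2.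
  have /= := Dscale n U (fun x => (a, f1 (p x) : R^o)); apply.
  by split; [exact: (plot_cst std_diffeology a (plot_open Dp))|exact: s1].
exact: (memv_vspace_of (Subspace sub)).
Qed.

Definition isotropic (g : V -> V -> R) : {vspace V} :=
  vspace_of [set v | forall w, g v w = 0].

Lemma isotropicP (g : V -> V -> R) v : bilinear_for *%R *%R g ->
  v \in isotropic g <-> forall w, g v w = 0.
Proof.
move=> [gl _].
have sub : is_subspace [set v | forall w, g v w = 0].
  split=> [w|a x y gx gy w] /=.
    by have := gl w (-1) 0 0; rewrite /= scaler0 addr0 mulN1r addNr.
  by have := gl w a x y; rewrite /= gx gy mulr0 addr0.
exact: (memv_vspace_of (Subspace sub)).
Qed.

Definition pseudo_metric (D : diffeology R V) (g : V -> V -> R) : Prop :=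
  [/\ smooth (prod_diffeology D D) std_diffeology (fun x => g x.1 x.2),
      bilinear_for *%R *%R g, forall v w, g v w = g w v, forall v, 0 <= g v v
    & \dim (isotropic g) = (\dim {:V} - \dim (diffeological_dual D))%N].

Definition gram_mx (g : V -> V -> R) (e : (\dim {:V}).-tuple V) :
    'M[R]_(\dim {:V}) := \matrix_(i, j) g e`_i e`_j.

(* The Gram matrix is symmetric, so that row and column eigenvectors agree. *)
Definition positive_eigenvectors (g : V -> V -> R) (e : (\dim {:V}).-tuple V) :
    set V :=
  [set v | v != 0 /\
     exists2 a : R, 0 < a & (passmx.rVof e v <= eigenspace (gram_mx g e) a)%MS].

(* The pseudo-metric used to compute the subspace is an arbitrary one. *)
Definition characteristic_subspace (D : diffeology R V) (V0 : {vspace V}) : Prop :=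
  exists (e : (\dim {:V}).-tuple V) (g : V -> V -> R),
    [/\ basis_of {:V} e, pseudo_metric D g & V0 = vspan (positive_eigenvectors g e)].

Definition restrict_form (g : V -> V -> R) (V0 : {vspace V}) :
    subvs_of V0 -> subvs_of V0 -> R := fun x y => g (vsval x) (vsval y).

End pseudo_metrics.
Arguments restrict_form {R V} g V0.

(* Main.v *)
From HB Require Import structures.
Require Import Defs.
From mathcomp Require Import all_boot all_order all_algebra.
From mathcomp Require Import all_classical all_reals topology normedtype derive.
From mathcomp Require Import spectral complex.

(* A pseudo-metric g induces a map w |-> g(w, .) onto the diffeological dual, so
   its isotropic subspace V1 is the annihilator of the dual and does not depend
   on g; hence V = V0 + V1 is direct by diagonalization of the Gram matrix. Every
   linear functional vanishing on V1 is of the form g(w, .), hence smooth, so the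
   projection P of V onto V0 along V1 is smooth. As g(Pv, Pw) = g(v, w), it
   induces a smooth map of Clifford algebras that is a left inverse of the
   smooth map i induced by the inclusion of V0, and the kernel of this left
   inverse is the smooth complement of the range of i. *)

Set Implicit Arguments.
Unset Strict Implicit.
Unset Printing Implicit Defensive.
Import Order.TTheory GRing.Theory Num.Theory numFieldNormedType.Exports.
Local Open Scope classical_set_scope.
Local Open Scope ring_scope.

(** * Vector space diffeologies and smooth retracts *)

Section diffeological_vector_spaces.
Context {R : realType}.

Section operations.
Context {E : lmodType R} (D : diffeology R E) (vD : vs_diffeology D).

Lemma plotD n (U : set 'rV[R]_n) (p q : 'rV[R]_n -> E) :
  plot D U p -> plot D U q -> plot D U (fun x => p x + q x).
Proof.
by move=> Dp Dq; apply: (vD.1 _ _ (fun x => (p x, q x))); split.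
Qed.

Lemma plotZ n (U : set 'rV[R]_n) (a : 'rV[R]_n -> R) (p : 'rV[R]_n -> E) :
  plot std_diffeology U a -> plot D U p -> plot D U (fun x => a x *: p x).
Proof.
by move=> Da Dp; apply: (vD.2 _ _ (fun x => (a x, p x))); split.
Qed.

Lemma plotB n (U : set 'rV[R]_n) (p q : 'rV[R]_n -> E) :
  plot D U p -> plot D U q -> plot D U (fun x => p x - q x).
Proof.
move=> Dp Dq; have Da := plot_cst std_diffeology (-1) (plot_open Dp).
by apply: plot_eq (plotD Dp (plotZ Da Dq)) => x _; rewrite scaleN1r.
Qed.

Lemma plot_sum n (U : set 'rV[R]_n) k (p : 'I_k -> 'rV[R]_n -> E) : open U ->
  (forall j, plot D U (p j)) -> plot D U (fun x => \sum_j p j x).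
Proof.
move=> oU; elim: k p => [|k IH] p Dp.
  by apply: plot_eq (plot_cst D 0 oU) => x _; rewrite big_ord0.
apply: (plot_eq _ (plotD (Dp ord0) (IH (fun j => p (lift ord0 j)) _))) => [x _|j //].
by rewrite big_ord_recl.
Qed.

End operations.

Lemma pullback_vs (E F : lmodType R) (D : diffeology R F) (f : E -> F) :
  linear f -> vs_diffeology D -> vs_diffeology (pullback_diffeology f D).
Proof.
move=> lf vD; split=> n U p [Dp1 Dp2].
  apply: plot_eq (plotD vD Dp1 Dp2) => x _ /=.
  by have := lf 1 (p x).1 (p x).2; rewrite !scale1r.
by apply: plot_eq (plotZ vD Dp1 Dp2) => x _ /=; rewrite (linearZ_prop _ _ lf).
Qed.

Lemma quotient_vs (E F : lmodType R) (f : E -> F)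
    (f_surj : forall y, exists x, f x = y) (D : diffeology R E) :
  linear f -> vs_diffeology D -> vs_diffeology (quotient_diffeology f_surj D).
Proof.
move=> lf vD; split=> n U p.
  move=> [[oU D1] [_ D2]]; split=> // x Ux.
  have [W1 [q1 [W1x W1U Dq1 pq1]]] := D1 x Ux.
  have [W2 [q2 [W2x W2U Dq2 pq2]]] := D2 x Ux.
  have oW := openI (plot_open Dq1) (plot_open Dq2).
  exists (W1 `&` W2), (fun y => q1 y + q2 y); split=> //.
  - by move=> y [/W1U].
  - by apply: plotD => //; [apply: plot_sub Dq1|apply: plot_sub Dq2] => // y [].
  move=> y [/pq1 /= -> /pq2 /= ->].
  by have := lf 1 (q1 y) (q2 y); rewrite !scale1r.
move=> [Da [oU D2]]; split=> // x Ux.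
have [W [q [Wx WU Dq pq]]] := D2 x Ux.
exists W, (fun y => (p y).1 *: q y); split=> //.
  by apply: plotZ => //; apply: plot_sub Da => //; exact: plot_open Dq.
by move=> y /pq /= ->; rewrite (linearZ_prop _ _ lf).
Qed.

(** Padding with the zero plot brings two local presentations to a common number of summands, so
    that they can be added termwise. *)
Lemma dsum_plot_ge (T : nat -> lmodType R) (D : forall k, diffeology R (T k)) n
    (W : set 'rV[R]_n) N M (q : forall k, 'rV[R]_n -> T k) :
  open W -> (N <= M)%N -> (forall k, (k < N)%N -> plot (D k) W (q k)) ->
  exists2 q' : forall k, 'rV[R]_n -> T k,
    forall k, plot (D k) W (q' k) &
    forall y, \sum_(k < N) dsum_inj (q k y) = \sum_(k < M) dsum_inj (q' k y).
Proof.
move=> oW NM Dq; exists (fun k y => if (k < N)%N then q k y else 0) => [k|y].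
  by case: (ltnP k N) => [/Dq|_] //; exact: plot_cst.
pose F k : dsum T := dsum_inj (if (k < N)%N then q k y else 0).
rewrite -(big_mkord xpredT F) (big_cat_nat _ NM) //= big_mkord.
rewrite [X in _ + X]big_nat_cond [X in _ + X]big1 ?addr0.
  by apply: eq_bigr => k _; rewrite /F ltn_ord.
by move=> k /andP[/andP[Nk _] _]; rewrite /F ltnNge Nk /= linear0.
Qed.

Lemma dsum_vs (T : nat -> lmodType R) (D : forall k, diffeology R (T k)) :
  (forall k, vs_diffeology (D k)) -> vs_diffeology (dsum_diffeology D).
Proof.
move=> vD; split=> n U p.
  move=> [[oU D1] [_ D2]]; split=> // x Ux.
  have [W1 [N1 [q1 [[oW1 W1x] W1U Dq1 pq1]]]] := D1 x Ux.
  have [W2 [N2 [q2 [[oW2 W2x] W2U Dq2 pq2]]]] := D2 x Ux.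
  have [r1 Dr1 qr1] := dsum_plot_ge oW1 (leq_maxl N1 N2) Dq1.
  have [r2 Dr2 qr2] := dsum_plot_ge oW2 (leq_maxr N1 N2) Dq2.
  have oW := openI oW1 oW2.
  exists (W1 `&` W2), (maxn N1 N2), (fun k y => r1 k y + r2 k y); split=> //.
  - by move=> y [/W1U].
  - move=> k _; apply: (plotD (vD k)).
      by apply: plot_sub (Dr1 k) => // y [].
    by apply: plot_sub (Dr2 k) => // y [].
  move=> y [/pq1 /= -> /pq2 /= ->]; rewrite qr1 qr2 -big_split /=.
  by apply: eq_bigr => k _; rewrite linearD.
move=> [Da [oU D2]]; split=> // x Ux.
have [W [N [q [[oW Wx] WU Dq pq]]]] := D2 x Ux.
exists W, N, (fun k y => (p y).1 *: q k y); split=> //.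
  by move=> k kN; apply: (plotZ (vD k)); [apply: plot_sub Da|exact: Dq].
move=> y /pq /= ->; rewrite scaler_sumr.
by apply: eq_bigr => k _; rewrite linearZ.
Qed.

(** The pullback of [D'] along [h] is a vector space diffeology for which [f] is smooth, so it
    contains the finest one. *)
Lemma finest_vs_lift X (D : diffeology R X) (E F : lmodType R) (f : X -> E)
    (D' : diffeology R F) (h : E -> F) : linear h -> vs_diffeology D' ->
  smooth D D' (h \o f) -> smooth (finest_vs_diffeology D f) D' h.
Proof.
move=> lh vD' shf n U p.
by apply: (finest_vs_min (pullback_vs lh vD')) => m W r /shf.
Qed.

Lemma quotient_smooth X Y X' Y' (D : diffeology R X) (D' : diffeology R X')
    (f : X -> Y) (f_surj : forall y, exists x, f x = y)
    (f' : X' -> Y') (f'_surj : forall y, exists x, f' x = y)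
    (h : X -> X') (k : Y -> Y') :
  (forall x, k (f x) = f' (h x)) -> smooth D D' h ->
  smooth (quotient_diffeology f_surj D) (quotient_diffeology f'_surj D') k.
Proof.
move=> kf sh n U p [oU Dp]; split=> // x /Dp[W [q [Wx WU Dq pq]]].
by exists W, (h \o q); split=> //; [exact: sh|move=> y /pq /= ->].
Qed.

(** In [x = i (r x) + (x - i (r x))] the first term lies in the range of [i], the second in the
    kernel of [r], and both depend smoothly on [x]. The induction part recovers a plot [p] as
    [r \o (i \o p)]. *)
Lemma smooth_retract_splits (E F : lmodType R) (DE : diffeology R E)
    (DF : diffeology R F) (i : F -> E) (r : E -> F) :
  vs_diffeology DE -> linear i -> linear r -> cancel i r ->
  smooth DF DE i -> smooth DE DF r ->
  is_induction DF DE i /\ splits_off_smoothly DE (range i).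
Proof.
move=> vE li lr ri si sr; split.
  split=> [|n U p]; first exact: can_inj ri.
  split=> [/si//|/sr]; apply: plot_eq => x _ /=.
  by rewrite ri.
pose K : set E := [set x | r x = 0].
have rangeE (u : range i) : i (r (set_val u)) = set_val u.
  have [y _ e] := set_mem (valP u); change (i (r (val u)) = val u).
  by rewrite -e ri.
have KE (u : K) : r (set_val u) = 0 by exact: set_mem (valP u).
have rD x y : r (x + y) = r x + r y.
  by have := lr 1 x y; rewrite !scale1r.
exists K; split.
- split=> [|a _ _ [x _ <-] [y _ <-]]; first by exists 0; rewrite ?(linear0_prop li).
  by exists (a *: x + y); rewrite ?li.
- split=> [|a x y]; rewrite /K /=; first exact: linear0_prop.
  by move=> rx ry; rewrite lr rx ry scaler0 addr0.
- have iP x : i (r x) \in range i by apply/mem_set; exists (r x).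
  have kP x : x - i (r x) \in K.
    by apply/mem_set; rewrite /K /= (linearB_prop lr) ri subrr.
  exists (fun x => (SigSub (iP x) : range i, SigSub (kP x) : K)) => [[u v]|x].
    rewrite /add_map /=; congr pair; apply: val_inj => /=.
      by rewrite rD KE addr0; exact: rangeE.
    by rewrite rD KE addr0 rangeE addrC addKr.
  by rewrite /add_map /set_val /= addrC subrK.
move=> n U p; split=> [[D1 D2]|Dp]; first exact: plotD D1 D2.
(* Applying [i \o r] to the sum kills the kernel component and fixes the other one. *)
have D1 : plot DE U (fun x => set_val (p x).1).
  apply: plot_eq (si _ _ _ (sr _ _ _ Dp)) => x _ /=.
  by rewrite rD KE addr0 rangeE.
split; first exact: D1.
apply: plot_eq (plotB vE Dp D1) => x _ /=.
by rewrite /add_map addrC addKr.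
Qed.

End diffeological_vector_spaces.

(** * Smooth functoriality of tensor and Clifford algebras *)

Section clifford_functoriality.
Context {R : realType}.

Lemma tensor_power_vs (V : lmodType R) (D : diffeology R V) k :
  vs_diffeology (tensor_power_diffeology D k).
Proof. by apply: quotient_vs (finest_vs_vs _ _); exact: linearP. Qed.

Lemma clifford_vs (V : lmodType R) (D : diffeology R V) (q : V -> V -> R) :
  vs_diffeology (clifford_diffeology D q).
Proof.
apply: quotient_vs; first exact: linearP.
by apply: dsum_vs => k; exact: tensor_power_vs.
Qed.

Context {V W : lmodType R} (D : diffeology R V) (D' : diffeology R W).
Context (f : {linear V -> W}).
Hypothesis sf : smooth D D' f.

(** Smoothness descends from the free space to the quotient; on the free space it is tested on
    generators, where the map applies [f] entrywise. *)
Lemma tensor_power_map_smooth k :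
  smooth (tensor_power_diffeology D k) (tensor_power_diffeology D' k)
    (@tensor_power_map R V W f k).
Proof.
apply: quotient_smooth; first exact: tensor_power_map_pi.
apply: finest_vs_lift; first exact: linearP.
  exact: finest_vs_vs.
move=> n U p [oU Dp].
apply: (plot_eq (q := fgen \o (map_tuple f \o p))) => [x _ /=|].
  by rewrite free_lift_gen.
apply: finest_vs_smooth; split=> // j.
by apply: plot_eq (sf (Dp j)) => x _ /=; rewrite tnth_map.
Qed.

Lemma tensor_algebra_map_smooth :
  smooth (tensor_algebra_diffeology D) (tensor_algebra_diffeology D')
    (tensor_algebra_map f).
Proof.
move=> n U p [oU Dp]; split=> // x /Dp[U' [N [q [oU' U'U Dq pq]]]].
exists U', N, (fun k => @tensor_power_map R V W f k \o q k); split=> //.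
  by move=> k kN; apply: tensor_power_map_smooth; exact: Dq.
move=> y /pq /= ->; rewrite (linear_sum (tensor_algebra_map f)).
by apply: eq_bigr => k _; exact: tensor_algebra_map_in.
Qed.

Lemma clifford_map_smooth (q : V -> V -> R) (q' : W -> W -> R) :
  (forall v w, q' (f v) (f w) = q v w) ->
  smooth (clifford_diffeology D q) (clifford_diffeology D' q')
    (clifford_map f (q := q) q').
Proof.
move=> qf; apply: quotient_smooth tensor_algebra_map_smooth.
exact: clifford_map_pi.
Qed.

End clifford_functoriality.

Lemma clifford_map_cancel {R : realType} (V W : lmodType R)
    (f : {linear V -> W}) (h : {linear W -> V})
    (q : V -> V -> R) (q' : W -> W -> R) :
  (forall v w, q' (f v) (f w) = q v w) -> (forall v w, q (h v) (h w) = q' v w) ->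
  cancel f h -> cancel (clifford_map f (q := q) q') (clifford_map h (q := q') q).
Proof.
move=> qf qh fK y; have [x <-] := clifford_surj y.
rewrite !clifford_map_pi //; congr clifford_pi; move: x.
apply: talg_ext => [a x z|//|s]; first by rewrite !linearP.
by rewrite !tensor_algebra_map_word (mapK fK).
Qed.

(** * Diagonalization of real symmetric matrices *)

(* Over R[i] the matrix is hermitian, hence diagonalizable with real eigenvalues,
   and the minimal polynomial does not change under field extension. *)
Lemma symmetric_eigenspaces (R : rcfType) n (A : 'M[R]_n) : A^T = A ->
  exists2 rs, uniq rs & (\sum_(r <- rs) eigenspace A r :=: 1%:M)%MS.
Proof.
case: n A => [|n] A As.
  by exists [::] => //; rewrite big_nil; apply/eqmxP; rewrite sub0mx thinmx0 sub0mx.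
apply/diagonalizablePeigen; apply/diagonalizableP.
pose f : {rmorphism R -> R[i]%C} := real_complex R.
have fA : map_mx f A \is hermsymmx.
  apply/is_hermitianmxP; rewrite expr0 scale1r map_trmx As.
  by apply/matrixP => i j; rewrite !mxE; exact/esym/conjc_real.
have [sp spR spE] : exists2 sp : 'rV_n.+1, forall i, sp 0 i \is Num.real &
    mxminpoly (map_mx f A) = mxminpoly (diag_mx sp).
  exists (spectral_diag (map_mx f A)).
    by move=> i; apply/mxOverP/hermitian_spectral_diag_real.
  have /orthomx_spectralP := hermitian_normalmx fA.
  move: (spectral_unit (map_mx f A)).
  move: (spectralmx (map_mx f A)) (spectral_diag (map_mx f A)) => P sp Pu ->.
  have Pi : invmx P \in unitmx by rewrite unitmx_inv.
  by rewrite -(mxminpoly_uconj (diag_mx sp) Pi) (conjumx _ Pi) invmxK.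
(* The eigenvalues are real elements of [R[i]]; their real parts bring them back to [R] without
   loss. *)
pose rs := [seq complex.Re (sp 0 i) | i <- enum 'I_n.+1].
exists (undup rs); first exact: undup_uniq.
(* Divisibility is checked over [R[i]], where the minimal polynomial of [diag_mx sp] is the product
   of the linear factors of its distinct entries. *)
rewrite -(dvdp_map f) -mxminpoly_map spE mxminpoly_diag.
have -> : [seq sp 0 i | i <- enum 'I_n.+1] = map f rs.
  by rewrite /rs -[RHS]map_comp; apply: eq_map => i; exact: esym (RRe_real (spR i)).
rewrite (undup_map_inj (@complexI R)) big_map rmorph_prod /=.
by under [X in _ %| X]eq_bigr do rewrite map_polyXsubC.
Qed.

Lemma mulmx_tr_ge0 (R : realDomainType) n (u : 'rV[R]_n) : 0 <= (u *m u^T) 0 0.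
Proof. by rewrite mxE sumr_ge0 // => i _; rewrite [u^T _ _]mxE -expr2 sqr_ge0. Qed.

Lemma mulmx_tr_eq0 (R : realDomainType) n (u : 'rV[R]_n) :
  ((u *m u^T) 0 0 == 0) = (u == 0).
Proof.
apply/eqP/eqP => [|->]; last by rewrite mul0mx mxE.
rewrite mxE => /psumr_eq0P u0; apply/rowP => i; rewrite [RHS]mxE.
suff /(_ i isT)/eqP : forall j, true -> u 0 j * u^T j 0 = 0.
  by rewrite [u^T _ _]mxE mulf_eq0 orbb => /eqP.
by apply: u0 => j _; rewrite [u^T _ _]mxE -expr2 sqr_ge0.
Qed.

(** * Symmetric bilinear forms and their Gram matrices *)

Section bilinear_forms.
Context {R : realType} {V : vectType R} (g : V -> V -> R).
Hypotheses (bg : bilinear_for *%R *%R g) (gC : forall v w, g v w = g w v).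

(** Serves functions such as [g w], whose linearity is a hypothesis and not a canonical
    structure. *)
Lemma linfun_linear (U W : vectType R) (f : U -> W) : linear f -> linfun f =1 f.
Proof.
move=> lf v; pose F : {linear U -> W} :=
  HB.pack f (GRing.isLinear.Build R U W *:%R f lf).
exact: (lfunE F v).
Qed.

(** Bundling the form as a linear map into the full dual makes the rank theorem available. *)
Definition form_hom : 'Hom(V, 'Hom(V, R^o)) :=
  linfun (fun w => linfun (g w : V -> R^o)).

Lemma form_homE v w : form_hom v w = g v w.
Proof.
have gE u x : linfun (g u : V -> R^o) x = g u x.
  by apply: linfun_linear => a y z; rewrite (bg.2 u).
rewrite /form_hom linfun_linear ?gE // => a x y.
by apply/lfunP => z; rewrite !lfunE /= !lfunE /= !gE (bg.1 z).
Qed.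

Lemma lker_form_hom : lker form_hom = isotropic g.
Proof.
apply/vspaceP => v; rewrite memv_ker; apply/eqP/idP => [fv|/(isotropicP _ bg) gv].
  by apply/(isotropicP _ bg) => w; rewrite -form_homE fv lfunE.
by apply/lfunP => w; rewrite form_homE gv lfunE.
Qed.

Lemma bilinear_gram_mx (e : (\dim {:V}).-tuple V) v w : basis_of {:V} e ->
  g v w = (passmx.rVof e v *m gram_mx g e *m (passmx.rVof e w)^T) 0 0.
Proof.
move=> be; rewrite {1}(coord_basis be (memvf v)) {1}(coord_basis be (memvf w)).
have gsuml I (r : seq I) (F : I -> V) x : g (\sum_(i <- r) F i) x = \sum_(i <- r) g (F i) x.
  rewrite -!form_homE linear_sum sum_lfunE.
  by apply: eq_bigr => i _; exact: form_homE.
rewrite gC gsuml mxE; apply: eq_bigr => j _; rewrite -!form_homE linearZ lfunE /=.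
rewrite form_homE gC gsuml !mxE mulrC; congr (_ * _).
by apply: eq_bigr => i _; rewrite !mxE -!form_homE linearZ lfunE.
Qed.

Lemma gram_mx_sym e : (gram_mx g e)^T = gram_mx g e.
Proof. by apply/matrixP => i j; rewrite !mxE gC. Qed.

(** A row vector that kills the kernel of the Gram matrix lies in its row space. No smoothness of
    [f] is assumed, so this is a source of smooth functionals. *)
Lemma form_of_annihilates_isotropic (f : 'Hom(V, R^o)) :
  (forall v, v \in isotropic g -> f v = 0) -> exists w, forall v, f v = g w v.
Proof.
move=> f0; pose e := vbasis {:V}; have be : basis_of {:V} e by exact: vbasisP.
pose A := gram_mx g e; pose phi : 'rV[R]_(\dim {:V}) := \row_i f e`_i.
have fE v : f v = (phi *m (passmx.rVof e v)^T) 0 0.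
  rewrite {1}(coord_basis be (memvf v)) linear_sum mxE; apply: eq_bigr => i _.
  by rewrite linearZ !mxE mulrC.
(* The columns of [cokermx A] are isotropic, so [phi] lies in the row space of [A]. *)
have /submxP[y phiE] : (phi <= A)%MS.
  rewrite submxE; apply/eqP/matrixP => i k; rewrite ord1 !mxE.
  pose u := passmx.vecof e (col k (cokermx A))^T.
  have uE : (passmx.rVof e u)^T = col k (cokermx A).
    by rewrite passmx.vecofK // trmxK.
  have : f u = 0.
    apply/f0/isotropicP => // w; rewrite gC (bilinear_gram_mx _ _ be).
    by rewrite uE -mulmxA colE [A *m (_ *m _)]mulmxA mulmx_coker mul0mx mulmx0 mxE.
  by rewrite fE uE mxE => fu0; rewrite -[RHS]fu0; apply: eq_bigr => j _; rewrite !mxE.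
exists (passmx.vecof e y) => v.
by rewrite fE phiE (bilinear_gram_mx _ _ be) passmx.vecofK.
Qed.

End bilinear_forms.

(** * Pseudo-metrics, the diffeological dual and smooth endomorphisms *)

Section pseudo_metrics.
Context {R : realType} {V : vectType R} (D : diffeology R V).
Implicit Types (g : V -> V -> R) (e : (\dim {:V}).-tuple V).

Lemma form_smooth g w : pseudo_metric D g ->
  smooth D std_diffeology (g w : V -> R).
Proof.
move=> [sg _ _ _ _] n U p Dp; apply: (sg n U (fun x => (w, p x))).
by split=> //; exact: plot_cst (plot_open Dp).
Qed.

(** The image of [form_hom g] lies in the dual, and the prescribed dimension of the isotropic
    subspace forces equality by the rank theorem. *)
Lemma dual_eq_form g (f : 'Hom(V, R^o)) : pseudo_metric D g ->
  f \in diffeological_dual D -> exists w, forall v, f v = g w v.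
Proof.
move=> pg; have [_ bg _ _ dg] := pg.
have sub : (limg (form_hom g) <= diffeological_dual D)%VS.
  apply/subvP => _ /memv_imgP[w _ ->]; apply/diffeological_dualP.
  have -> : (form_hom g w : V -> R) = g w.
    by apply/funext => v; exact: form_homE.
  exact: form_smooth.
have : limg (form_hom g) == diffeological_dual D.
  rewrite eqEdim sub /=.
  have := limg_ker_dim (form_hom g) fullv.
  rewrite capfv lker_form_hom // dg => dE.
  (* The subtraction in [pseudo_metric] is truncated; this bound makes it exact. *)
  have dle : (\dim (diffeological_dual D) <= \dim {:V})%N.
    by apply: leq_trans (dimvS (subvf _)) _; rewrite !dimvf /dim /= muln1.
  by rewrite -(leq_add2l (\dim {:V} - \dim (diffeological_dual D))) dE subnK.
move=> /eqP <- /memv_imgP[w _ ->]; exists w => v; exact: form_homE.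
Qed.

(** Each functional [g2 w] is smooth, hence of the form [g1 u], and so vanishes on the isotropic
    subspace of [g1]. *)
Lemma isotropic_unique g g' : pseudo_metric D g -> pseudo_metric D g' ->
  isotropic g = isotropic g'.
Proof.
suff sub g1 g2 : pseudo_metric D g1 -> pseudo_metric D g2 ->
    (isotropic g1 <= isotropic g2)%VS.
  by move=> pg pg'; apply/eqP; rewrite eqEsubv !sub.
move=> p1 p2; have [_ b1 C1 _ _] := p1; have [_ b2 C2 _ _] := p2.
apply/subvP => v /(isotropicP _ b1) v1; apply/isotropicP => // w.
have : form_hom g2 w \in diffeological_dual D.
  apply/diffeological_dualP.
  have -> : (form_hom g2 w : V -> R) = g2 w.
    by apply/funext => x; exact: form_homE.
  exact: form_smooth.
by move=> /(dual_eq_form p1)[u uE]; rewrite C2 -form_homE // uE C1.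
Qed.

(** Each coordinate of [h] vanishes on the isotropic subspace, hence has the form [g w] and is
    smooth; [h] is the sum of these coordinates times constant vectors. *)
Lemma smooth_of_isotropic g (h : 'End(V)) : vs_diffeology D ->
  pseudo_metric D g -> (forall v, v \in isotropic g -> h v = 0) ->
  smooth D D h.
Proof.
move=> vD pg h0; have [_ bg gC _ _] := pg.
pose e := vbasis {:V}; have be : basis_of {:V} e by exact: vbasisP.
move=> n U p Dp; have oU := plot_open Dp.
apply: (plot_eq (q := fun x => \sum_i coord e i (h (p x)) *: e`_i)) => [x _ /=|].
  exact: coord_basis (memvf _).
apply: (plot_sum vD) => // i; apply: plotZ => //; last exact: plot_cst.
pose f : 'Hom(V, R^o) := (linfun (coord e i : V -> R^o) \o h)%VF.
have fE v : f v = coord e i (h v).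
  by rewrite /f lfunE /= linfun_linear // => a y z; rewrite linearP.
have [|w wE] := @form_of_annihilates_isotropic _ _ _ bg gC f.
  by move=> v /h0 hv; rewrite fE hv linear0.
apply: plot_eq (form_smooth w pg Dp) => x _ /=.
by rewrite -wE fE.
Qed.

(** * Splitting of the space by the eigenvalues of the Gram matrix *)

Section eigenvectors.
Variables (g : V -> V -> R) (e : (\dim {:V}).-tuple V).
Hypotheses (be : basis_of {:V} e) (pg : pseudo_metric D g).
Local Notation V0 := (vspan (positive_eigenvectors g e)).

(** With [A] the Gram matrix, an eigenvector for a nonzero eigenvalue lies in the row space of [A],
    so coordinates of [x] in [V0] have the form [y *m A]. If [x] is also isotropic, its squared
    coordinate norm is a value of [g] at [x], hence zero. *)
Lemma vspan_isotropic_capv : (V0 :&: isotropic g)%VS = 0%VS.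
Proof.
have [_ bg gC _ _] := pg; apply/eqP; rewrite -subv0; apply/subvP => x.
rewrite memv_cap => /andP[/memv_vspace_of xV0 /(isotropicP _ bg) xg].
have sub : is_subspace [set x | (passmx.rVof e x <= gram_mx g e)%MS].
  split=> [|a y z /= ya za]; first by rewrite /= (linear0_prop (passmx.rVof_linear e)) sub0mx.
  by rewrite passmx.rVof_linear addmx_sub ?scalemx_sub.
have /(xV0 (Subspace sub))/= /submxP[y yE] : 
    positive_eigenvectors g e `<=` [set x | (passmx.rVof e x <= gram_mx g e)%MS].
  move=> v [_ [a a0 /eigenspaceP va]] /=.
  have -> : passmx.rVof e v = a^-1 *: passmx.rVof e v *m gram_mx g e.
    by rewrite -scalemxAl va scalerA mulVf ?gt_eqF // scale1r.
  exact: submxMl.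
have : (passmx.rVof e x *m (passmx.rVof e x)^T) 0 0 = 0.
  by rewrite {1}yE -(xg (passmx.vecof e y)) gC (bilinear_gram_mx bg gC _ _ be) passmx.vecofK.
by move/eqP; rewrite mulmx_tr_eq0 (passmx.rVof_eq0 be) memv0.
Qed.

(** The eigenspaces span everything. Positive eigenvalues contribute to [V0], the eigenvalue zero
    gives isotropic vectors, and a negative one would make [g u u] negative. *)
Lemma vspan_isotropic_addv : (V0 + isotropic g)%VS = fullv.
Proof.
have [_ bg gC g0 _] := pg; apply/eqP; rewrite eqEsubv subvf; apply/subvP => v _.
pose A := gram_mx g e; have [rs _ rsE] := symmetric_eigenspaces (gram_mx_sym gC e).
have sub r : (eigenspace A r <= passmx.msof e (V0 + isotropic g))%MS.
  apply/row_subP => i; rewrite -passmx.mem_vecof //.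
  set u := passmx.vecof e _; have uE : passmx.rVof e u *m A = r *: passmx.rVof e u.
    by apply/eigenspaceP; rewrite passmx.vecofK // row_sub.
  have guw w : g u w = r * (passmx.rVof e u *m (passmx.rVof e w)^T) 0 0.
    by rewrite (bilinear_gram_mx bg gC _ _ be) uE -scalemxAl mxE.
  have [->|u0] := eqVneq u 0; first exact: mem0v.
  have [r0|r0|r0] := ltrgt0P r.
  - apply: (subvP (addvSl _ _)); apply/memv_vspace_of/lin_span_sub; split=> //.
    by exists r => //; apply/eigenspaceP.
  - have := g0 u; rewrite guw nmulr_rge0 // leNgt; case/negP.
    by rewrite lt_neqAle mulmx_tr_ge0 eq_sym mulmx_tr_eq0 (passmx.rVof_eq0 be) u0.
  apply: (subvP (addvSr _ _)); apply/isotropicP => // w.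
  by rewrite guw r0 mul0r.
rewrite -(passmx.rVofK be v) passmx.mem_vecof //.
apply: submx_trans (submx1 _) _; rewrite -rsE.
by elim/big_ind: _ => // [|B C HB HC]; rewrite ?sub0mx // addsmx_sub HB.
Qed.

End eigenvectors.

End pseudo_metrics.

(** * The smooth splitting of the Clifford algebra *)

Theorem lemma3p6 (R : realType) (V : vectType R) (D : diffeology R V)
    (g : V -> V -> R) (V0 : {vspace V}) :
  vs_diffeology D -> pseudo_metric D g -> characteristic_subspace D V0 ->
  let D0 := pullback_diffeology (vsval (U := V0)) D in
  let g0 := restrict_form g V0 in
  let i := @clifford_map _ _ _ (vsval (U := V0)) g0 g in
  is_induction (clifford_diffeology D0 g0) (clifford_diffeology D g) i /\
  splits_off_smoothly (clifford_diffeology D g) (range i).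
Proof.
move=> vD pg [e [g' [be pg' V0E]]] D0 g0 i.
(* [V0] is computed from [g'], which may differ from [g]; only their isotropic subspaces need to
   agree. *)
have capV : (V0 :&: isotropic g = 0)%VS.
  by rewrite V0E (isotropic_unique pg pg') (vspan_isotropic_capv be pg').
have addV : (V0 + isotropic g = fullv)%VS.
  by rewrite V0E (isotropic_unique pg pg') (vspan_isotropic_addv be pg').
have [_ bg gC _ _] := pg.
pose P := daddv_pi V0 (isotropic g); pose Q := daddv_pi (isotropic g) V0.
have PQ v : P v + Q v = v by rewrite daddv_pi_add // addV memvf.
pose f : {linear V -> subvs_of V0} := vsproj V0 \o P.
have fE v : vsval (f v) = P v by rewrite vsprojK // memv_pi.
have fK : cancel vsval f.
  by move=> x; apply: val_inj; rewrite [LHS]fE daddv_pi_id // subvsP.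
have gf v w : g0 (f v) (f w) = g v w.
  rewrite /g0 /restrict_form !fE -[in RHS](PQ v) -[in RHS](PQ w).
  have Q0 x y : g (Q x) y = 0 by apply: (isotropicP _ bg).1; exact: memv_pi.
  have /= := bg.1 (P w + Q w) 1 (P v) (Q v); rewrite scale1r mul1r => ->.
  have /= := bg.2 (P v) 1 (P w) (Q w); rewrite scale1r mul1r => ->.
  by rewrite Q0 (gC _ (Q w)) Q0 !addr0.
have P0 v : v \in isotropic g -> P v = 0.
  move=> vg; have := PQ v; rewrite /Q (daddv_pi_id _ vg) 1?capvC //.
  by move/(canRL (addrK v)); rewrite subrr.
have sP := smooth_of_isotropic vD pg P0.
apply: (@smooth_retract_splits _ _ _ _ _ i (clifford_map f (q := g) g0)).
- exact: clifford_vs.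
- exact: clifford_map_linear.
- exact: clifford_map_linear.
- exact: clifford_map_cancel.
- exact: clifford_map_smooth.
(* Smoothness of [f] into the subset diffeology of [V0] is smoothness of [P] as a map into [V]. *)
apply: clifford_map_smooth => // n U p Dp.
by apply: plot_eq (sP _ _ _ Dp) => x _; exact: fE.
Qed.
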